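(* Let $(X_t)_{t\ge0}$ be a time-homogeneous continuous-time Markov process with countable state space $S$ (transition rates not assumed symmetric), let $i\in S$, and suppose $p_t(i,i)\sim ct^{-\alpha}$ as $t\to\infty$ for some $c,\alpha>0$. Let $L_t=\int_0^t\mathbf 1_{\{X_s=i\}}\,ds$ for the process started in $i$. Let $\kappa>0$ and $\kappa=\frac1{G_\infty}$. Then, as $t\to\infty$, $$\mathbb{E}[e^{\kappa L_t}]\sim\begin{cases}t^{\alpha-1}\,\frac{\alpha-1}{\kappa c\,\Gamma(2-\alpha)\Gamma(\alpha)}&:1<\alpha<2,\\[1ex] \frac{t}{\log t}\,\frac1{\kappa c}&:\alpha=2,\\[1ex] t\,\frac{1}{\kappa H_\infty}&:\alpha>2.\end{cases}$$
   Context: $p_t(i,j)=\mathbb{P}[X_t=j\mid X_0=i]$; the process is a (conservative) continuous-time Markov chain with right-continuous paths. $G_\infty=\int_0^\infty p_t(i,i)\,dt\in(0,\infty]$ (with $1/\infty=0$; thus $\kappa=1/G_\infty>0$ forces $G_\infty<\infty$ and $\alpha>1$), $H_\infty=\int_0^\infty t\,p_t(i,i)\,dt$. $h_1\sim h_2$ means $\lim h_1/h_2=1$; $\Gamma$ is the Gamma function. *)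

(* Defs.v *)
From mathcomp Require Import all_boot all_order all_algebra.
From mathcomp Require Import all_classical all_reals all_analysis.

Set Implicit Arguments.
Unset Strict Implicit.
Unset Printing Implicit Defensive.

Import Order.TTheory GRing.Theory Num.Theory.
Import numFieldNormedType.Exports.

Local Open Scope classical_set_scope.
Local Open Scope ring_scope.

Definition asymp_equiv (R : realType) (f g : R -> R) : Prop :=
  f t / g t @[t --> +oo] --> (1 : R).

Definition Gamma (R : realType) (a : R) : R :=
  \int[lebesgue_measure]_(x in `]0, +oo[) (x `^ (a - 1) * expR (- x)).

Section Chain.
Context (d : measure_display) (T : measurableType d) (R : realType)
  (S : countType).

(* [X t w] is only meaningful for [0 <= t], and [P i] is the law of the process
   started in [i], i.e. the conditional law given [X_0 = i]. *)
Variables (X : R -> T -> S) (P : S -> probability T R).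

Definition state_at (t : R) (j : S) : set T := X t @^-1` [set j].

(* The sigma-algebra generated by the [X u], [0 <= u <= s], for the discrete
   sigma-algebra on [S]. *)
Definition history (s : R) : set (set T) :=
  <<s \bigcup_(u in `[0, s]) preimage_set_system setT (X u) setT >>.

Definition trans_prob (t : R) (i j : S) : R := fine (P i (state_at t j)).

(* Conservativity needs no separate clause: [X] takes its values in [S] at all
   times, so that the [trans_prob t i j] sum to 1 over [j]. *)
Record markov_chain : Prop := MarkovChain {
  mc_measurable : forall (t : R) (j : S), 0 <= t -> measurable (state_at t j);
  (* right-continuity of the paths for the discrete topology of [S] *)
  mc_right_continuous : forall (w : T) (t : R), 0 <= t ->
    \forall s \near t^'+, X s w = X t w;
  mc_init : forall i : S, P i (state_at 0 i) = 1%E;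
  mc_markov : forall (i j k : S) (s t : R) (A : set T),
    0 <= s -> 0 <= t -> history s A ->
    (P i (A `&` state_at s j `&` state_at (s + t) k) =
     P i (A `&` state_at s j) * (trans_prob t j k)%:E)%E }.

Definition local_time (i : S) (t : R) (w : T) : R :=
  \int[lebesgue_measure]_(s in `[0, t]) \1_[set u | X u w = i] s.

Definition exp_moment (k : R) (i : S) (t : R) : \bar R :=
  ('E_(P i)[fun w => expR (k * local_time i t w)])%E.

Definition G_infty (i : S) : \bar R :=
  (\int[lebesgue_measure]_(t in `[0%R, +oo[) (trans_prob t i i)%:E)%E.

Definition H_infty (i : S) : \bar R :=
  (\int[lebesgue_measure]_(t in `[0%R, +oo[) (t * trans_prob t i i)%:E)%E.

End Chain.

(* Main.v *)
From HB Require Import structures.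
Require Import Defs.
From mathcomp Require Import all_boot all_order all_algebra.
From mathcomp Require Import all_classical all_reals all_analysis.
From mathcomp Require Import measurable_realfun exponential_distribution.
From mathcomp Require Import ring lra.

Set Implicit Arguments.
Unset Strict Implicit.
Unset Printing Implicit Defensive.

Import Order.TTheory GRing.Theory Num.Theory.
Import numFieldNormedType.Exports.

Local Open Scope classical_set_scope.
Local Open Scope ring_scope.

(* With p(t) = p_t(i,i), L the local time and q(t) = E[exp(k L_t); X_t = i], the
   pathwise identity exp(k L_t) = 1 + k int_0^t exp(k L_s) 1{X_s = i} ds and the
   Markov property at time s give q = p + k p * q, hence the renewal equation
   M = 1 + k p * M for M(t) = E[exp(k L_t)]. Since k int p = 1 it is critical:
   with F(t) = k int_t^oo p one has 1 = F + k (1 * p), and convolving with M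
   leaves (M * F)(t) = t, where M is nondecreasing and F is explicit at
   infinity.

   For alpha >= 2 put m = 1 * F. Monotonicity of M gives
   t <= M(t) m(t) and M(t) m(e t) <= (1 + e) t; as m is slowly varying, M ~ t/m.

   For 1 < alpha < 2 convolve once more, with t^(alpha-2): the kernel
   w = F * t^(alpha-2) converges to a positive constant (a Beta integral), while
   M * w is an explicit power. This determines int_0^t M asymptotically, and M
   itself follows by monotone density; no Laplace transform is needed. *)

(** * Convolution of nonnegative functions *)

(** For [alpha <= 2] the density [k p] has infinite mean, so the classical renewal theorem gives no
    rate; the equation for [M * F] has an explicit right-hand side, and positivity and monotonicity
    then suffice. For [alpha < 2] the sandwich alone would lose a constant, as [m(e t) / m(t)] tends
    to [e^(2 - alpha)] instead of 1. The kernel [t^(alpha-2)] is dictated by [F], which decays like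
    [t^(1-alpha)]: with these exponents the convolution neither grows nor decays.

    All functions take values in [0, +oo] and vanish at negative times, so that Tonelli gives the
    algebra of convolution without integrability conditions. Only cancellations need finite terms,
    and these come from [M(t) <= exp(k t)]. The Markov property is available for events only: the
    weight [exp(k L_s)] has to be cut into its superlevel sets, each of which must belong to the
    history at time [s]. *)

Section affine_invariance.
Context {R : realType}.
Notation mu := (@lebesgue_measure R).

(** Lebesgue measure is determined by its values on half-open intervals, so only the preimage of
    such an interval under the map has to be measured. [integral_scale] rests on the same
    argument. *)
Lemma integral_shift (f : R -> \bar R) (a : R) :
  measurable_fun [set: R] f -> (forall x, 0 <= f x)%E ->
  (\int[mu]_x f (x + a)%R = \int[mu]_x f x)%E.
Proof.
move=> mf f0; pose phi : measurableTypeR R -> measurableTypeR R := fun x : R => x + a.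
have mphi : measurable_fun setT phi by exact: measurable_funD.
rewrite -[LHS](@ge0_integral_pushforward _ _ _ _ _ phi mphi mu setT f)//.
apply: eq_measure_integral => /= A mA _; apply/esym.
apply: lebesgue_measure_unique => //= _ [[b c]] _ <-.
rewrite /pushforward.
rewrite (_ : _ @^-1` _ = `]b - a, c - a]%classic); last first.
  by apply/seteqP; split => x /=; rewrite /phi !in_itv/= ltrBlDr lerBrDr.
by rewrite !lebesgue_measure_itv/= !lte_fin ltrD2r; case: ifP => // _; congr EFin; ring.
Qed.

Lemma integral_opp (f : R -> \bar R) :
  measurable_fun [set: R] f -> (forall x, 0 <= f x)%E ->
  (\int[mu]_x f (- x)%R = \int[mu]_x f x)%E.
Proof.
move=> mf f0; pose phi : measurableTypeR R -> measurableTypeR R := -%R.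
have mphi : measurable_fun setT phi by exact: oppr_measurable.
rewrite -[LHS](@ge0_integral_pushforward _ _ _ _ _ phi mphi mu setT f)//.
by apply: eq_measure_integral => /= A mA _; exact: lebesgue_measureN.
Qed.

Lemma integral_scale (f : R -> \bar R) (a : R) : 0 < a ->
  measurable_fun [set: R] f -> (forall x, 0 <= f x)%E ->
  (\int[mu]_x f x = a%:E * \int[mu]_x f (a * x)%R)%E.
Proof.
move=> a0 mf f0; pose phi : measurableTypeR R -> measurableTypeR R := fun x : R => a * x.
have mphi : measurable_fun setT phi by exact: measurable_funM.
rewrite -[X in (_ * X)%E](@ge0_integral_pushforward _ _ _ _ _ phi mphi mu setT f)//.
have -> (y : \bar R) : (a%:E * y = (NngNum (ltW a0))%:num%:E * y)%E by [].
rewrite -[RHS]ge0_integral_mscale//.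
apply: eq_measure_integral => /= A mA _.
apply: lebesgue_measure_unique => //= _ [[b c]] _ <-.
rewrite /mscale/= /pushforward.
rewrite (_ : _ @^-1` _ = `]b / a, c / a]%classic); last first.
  by apply/seteqP; split => x /=; rewrite /phi !in_itv/= ltr_pdivrMr// ler_pdivlMr// (mulrC x).
rewrite !lebesgue_measure_itv/= !lte_fin ltr_pM2r ?invr_gt0//; case: ifP => // _.
  by rewrite -EFinB -EFinM; congr EFin; field; rewrite gt_eqF.
by rewrite mule0.
Qed.

Lemma integral_reflect (f : R -> \bar R) (t : R) :
  measurable_fun [set: R] f -> (forall x, 0 <= f x)%E ->
  (\int[mu]_x f (t - x)%R = \int[mu]_x f x)%E.
Proof.
move=> mf f0.
under eq_integral do rewrite addrC.
rewrite (@integral_opp (fun x => f (x + t))) ?integral_shift//.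
by apply: measurableT_comp => //; exact: measurable_funD.
Qed.

End affine_invariance.

Section convolution.
Context {R : realType}.
Notation mu := (@lebesgue_measure R).
Local Open Scope ereal_scope.
Implicit Types f g k : R -> \bar R.

(** Taken over the whole line, so that changes of variables carry no bounds; one-sided convolution
    is recovered for functions that vanish at negative times. *)
Definition conv f g t := \int[mu]_s (f s * g (t - s)%R).

Let msub : measurable_fun setT (fun z : R * R => z.1 - z.2)%R.
Proof. by apply: measurable_funB. Qed.

Lemma conv_ge0 f g t : (forall x, 0 <= f x) -> (forall x, 0 <= g x) ->
  0 <= conv f g t.
Proof. by move=> f0 g0; apply: integral_ge0 => x _; rewrite mule_ge0. Qed.

Let mconv_integrand f g :
  measurable_fun setT f -> measurable_fun setT g ->
  measurable_fun setT (fun z : R * R => f z.2 * g (z.1 - z.2)%R).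
Proof.
move=> mf mg; apply: emeasurable_funM; first exact: measurableT_comp.
exact: measurableT_comp.
Qed.

Lemma measurable_conv f g :
  measurable_fun setT f -> measurable_fun setT g ->
  (forall x, 0 <= f x) -> (forall x, 0 <= g x) ->
  measurable_fun setT (conv f g).
Proof.
move=> mf mg f0 g0.
apply: (measurable_fun_fubini_tonelli_F (m2 := mu)
  (fun z : R * R => f z.2 * g (z.1 - z.2)%R)).
  exact: mconv_integrand.
by move=> x; rewrite mule_ge0.
Qed.

Lemma measurable_conv_fun f g t :
  measurable_fun setT f -> measurable_fun setT g ->
  measurable_fun setT (fun s => f s * g (t - s)%R).
Proof.
move=> mf mg; apply: emeasurable_funM => //; apply: measurableT_comp => //.
exact: measurable_funB.
Qed.

Lemma convC f g :
  measurable_fun setT f -> measurable_fun setT g ->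
  (forall x, 0 <= f x) -> (forall x, 0 <= g x) ->
  conv f g = conv g f.
Proof.
move=> mf mg f0 g0; apply/funext => t; rewrite /conv.
rewrite -(@integral_reflect R _ t); last 2 first.
- exact: measurable_conv_fun.
- by move=> x; rewrite mule_ge0.
by apply: eq_integral => x _; rewrite muleC subKr.
Qed.

Lemma convA f g k :
  measurable_fun setT f -> measurable_fun setT g -> measurable_fun setT k ->
  (forall x, 0 <= f x) -> (forall x, 0 <= g x) -> (forall x, 0 <= k x) ->
  conv f (conv g k) = conv (conv f g) k.
Proof.
move=> mf mg mk f0 g0 k0; apply/funext => t.
(* Shifting the inner variable by [s] makes the argument of [k] independent of [s]; Tonelli then
   exchanges the integrals. *)
transitivity (\int[mu]_s \int[mu]_u (f s * (g (u - s)%R * k (t - u)%R))).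
  apply: eq_integral => s _; rewrite /conv.
  rewrite -(@integral_shift R _ (- s)%R); last 2 first.
  - exact: measurable_conv_fun.
  - by move=> x; rewrite mule_ge0.
  rewrite ge0_integralZl//.
  - congr (_ * _); apply: eq_integral => u _; congr (_ * k _); ring.
  - apply: emeasurable_funM; apply: measurableT_comp => //.
      exact: measurable_funB.
    exact: measurable_funB.
  - by move=> x _; rewrite mule_ge0.
rewrite (@fubini_tonelli _ _ _ _ _ mu mu
  (fun z => f z.1 * (g (z.2 - z.1)%R * k (t - z.2)%R)))/=; last 2 first.
- apply: emeasurable_funM; first exact: measurableT_comp.
  apply: emeasurable_funM; apply: measurableT_comp => //.
    exact: measurable_funB.
  exact: measurable_funB.
- by move=> z; rewrite !mule_ge0.
apply: eq_integral => u _; rewrite /conv -ge0_integralZr//.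
- by apply: eq_integral => s _; rewrite muleA.
- exact: measurable_conv_fun.
- by move=> s _; rewrite mule_ge0.
Qed.

Lemma integral_conv f g :
  measurable_fun setT f -> measurable_fun setT g ->
  (forall x, 0 <= f x) -> (forall x, 0 <= g x) ->
  \int[mu]_t conv f g t = (\int[mu]_t f t) * \int[mu]_t g t.
Proof.
move=> mf mg f0 g0.
rewrite (@fubini_tonelli _ _ _ _ _ mu mu
  (fun z => f z.2 * g (z.1 - z.2)%R))/=; last 2 first.
- exact: mconv_integrand.
- by move=> z; rewrite mule_ge0.
rewrite -ge0_integralZr//; last exact: integral_ge0.
apply: eq_integral => s _; rewrite ge0_integralZl//.
- by rewrite (@integral_shift R g).
- by apply: measurableT_comp => //; exact: measurable_funB.
Qed.

Lemma convDl f g k t :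
  measurable_fun setT f -> measurable_fun setT g -> measurable_fun setT k ->
  (forall x, 0 <= f x) -> (forall x, 0 <= g x) -> (forall x, 0 <= k x) ->
  conv (fun x => f x + g x) k t = conv f k t + conv g k t.
Proof.
move=> mf mg mk f0 g0 k0; rewrite /conv -ge0_integralD//.
- by apply: eq_integral => s _; rewrite ge0_muleDl.
- by move=> x _; rewrite mule_ge0.
- exact: measurable_conv_fun.
- by move=> x _; rewrite mule_ge0.
- exact: measurable_conv_fun.
Qed.

Lemma convZl (a : R) f g t : (0 <= a)%R ->
  measurable_fun setT f -> measurable_fun setT g ->
  (forall x, 0 <= f x) -> (forall x, 0 <= g x) ->
  conv (fun x => a%:E * f x) g t = a%:E * conv f g t.
Proof.
move=> a0 mf mg f0 g0; rewrite /conv -ge0_integralZl//.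
- by apply: eq_integral => s _; rewrite muleA.
- exact: measurable_conv_fun.
- by move=> x _; rewrite mule_ge0.
Qed.

Lemma le_conv f g k l t :
  measurable_fun setT f -> measurable_fun setT g ->
  measurable_fun setT k -> measurable_fun setT l ->
  (forall x, 0 <= f x) -> (forall x, 0 <= g x) ->
  (forall x, 0 <= k x) -> (forall x, 0 <= l x) ->
  (forall s, f s * k (t - s)%R <= g s * l (t - s)%R) ->
  conv f k t <= conv g l t.
Proof.
move=> mf mg mk ml f0 g0 k0 l0 fg; apply: ge0_le_integral => //.
- by move=> x _; rewrite mule_ge0.
- exact: measurable_conv_fun.
- exact: measurable_conv_fun.
Qed.

End convolution.

(** * Exponential of an occupation time *)

(** Time is rounded up to a grid of mesh 1/(n+1). For each [n] the rounded set is a countable union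
    of rectangles, and by right-continuity membership at the rounded time eventually agrees with
    membership at [t], so the set is a lower limit of measurable sets. The type [T] is arbitrary
    because the sigma-algebra of the history is used as well. *)
Lemma measurable_right_continuous {R : realType} d (T : measurableType d)
    (A : R -> set T) :
  (forall t, measurable (A t)) ->
  (forall t w, \forall s \near t^'+, A s w = A t w) ->
  measurable [set z : T * R | A z.2 z.1].
Proof.
move=> mA rcA.
(* The first grid point strictly to the right of [t]: strict, as the filter [t^'+] only sees points
   beyond [t]. *)
pose r (n : nat) (t : R) : R := (Num.floor (t * n.+1%:R) + 1)%:~R / n.+1%:R.
have rP n t : t < r n t <= t + n.+1%:R^-1.
  have n0 : 0 < n.+1%:R :> R by rewrite ltr0n.
  rewrite /r ltr_pdivlMr// floorD1_gt/= ler_pdivrMr// mulrDl mulVf ?gt_eqF//.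
  by rewrite intrD lerD2r floor_le.
have mE n : measurable [set z : T * R | A (r n z.2) z.1].
  rewrite (_ : [set z | _] = \bigcup_(k : int)
      (A ((k + 1)%:~R / n.+1%:R) `*`
       [set t | k%:~R / n.+1%:R <= t < (k + 1)%:~R / n.+1%:R])); last first.
    apply/seteqP; split => [[w t]/= Awt|[w t] [k _] /= [Awt]].
      exists (Num.floor (t * n.+1%:R)) => //=; split => //.
      by rewrite ler_pdivrMr ?ltr0n// ltr_pdivlMr ?ltr0n// floor_itv.
    rewrite ler_pdivrMr ?ltr0n// ltr_pdivlMr ?ltr0n// => kt.
    by rewrite /r (eqP (_ : Num.floor (t * n.+1%:R) == k)) ?floor_eq.
  apply: countable_bigcupT_measurable => // k; apply: measurableX => //.
  rewrite (_ : [set t | _] = `[k%:~R / n.+1%:R, (k + 1)%:~R / n.+1%:R[%classic).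
    exact: measurable_itv.
  by apply/seteqP; split => x /=; rewrite in_itv.
have rA t w : \forall n \near \oo, A (r n t) w = A t w.
  have [e /= e0 eA] := rcA t w.
  have [N _ NP] := near_infty_natSinv_lt (PosNum e0).
  exists N => // n /= Nn; have /andP[tr rt] := rP n t.
  apply: eA => //=; rewrite ler0_norm ?subr_le0 1?ltW// opprB ltrBlDr addrC.
  by rewrite (le_lt_trans rt)// ltrD2l; exact: NP.
rewrite (_ : [set z | _] =
    \bigcup_N \bigcap_(n in [set n | (N <= n)%N]) [set z : T * R | A (r n z.2) z.1]).
  apply: bigcupT_measurable => N; apply: bigcap_measurableType => n _.
  exact: mE.
apply/seteqP; split => [[w t] /= Awt|[w t] [N _ /= NA]].
  by have [N _ NA] := rA t w; exists N => // n /= Nn; rewrite NA.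
have [N' _ N'A] := rA t w.
have <- := N'A (maxn N N') (leq_maxr _ _).
by apply: (NA (maxn N N')) => /=; exact: leq_maxl.
Qed.

(** Cutting [[0, T]] into n+1 equal pieces bounds the total increment by n+1 terms [K (T/(n+1))^2],
    a sum that tends to 0. *)
Lemma quadratic_increment_cst {R : realType} (f : R -> R) (K T : R) : 0 <= T ->
  (forall s t, 0 <= s -> s <= t -> t <= T -> `|f t - f s| <= K * (t - s) ^+ 2) ->
  f T = f 0.
Proof.
move=> T0 H.
have Hn (n : nat) : `|f T - f 0| <= K * T ^+ 2 / n.+1%:R.
  pose u (m : nat) := T * m%:R / n.+1%:R.
  have n0 : 0 < n.+1%:R :> R by rewrite ltr0n.
  have Hm (m : nat) : (m <= n.+1)%N ->
      `|f (u m) - f 0| <= m%:R * (K * (T / n.+1%:R) ^+ 2).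
    elim: m => [|m IH] mn; first by rewrite /u mulr0 mul0r subrr normr0 mul0r.
    have -> : f (u m.+1) - f 0 = (f (u m.+1) - f (u m)) + (f (u m) - f 0) by ring.
    rewrite (le_trans (ler_normD _ _))// -natr1 mulrDl mul1r addrC lerD//.
      by rewrite IH// ltnW.
    have -> : T / n.+1%:R = u m.+1 - u m by rewrite /u -natr1; field; rewrite gt_eqF.
    apply: H.
    - by rewrite /u !mulr_ge0.
    - by rewrite /u ler_pM2r ?invr_gt0// ler_wpM2l// ler_nat.
    - by rewrite /u ler_pdivrMr// ler_wpM2l// ler_nat.
  have := Hm n.+1 (leqnn _); rewrite /u mulfK ?gt_eqF// => /le_trans; apply.
  by rewrite le_eqVlt; apply/orP; left; apply/eqP; field; rewrite gt_eqF.
apply/eqP; rewrite -subr_eq0 -normr_le0; apply/ler_addgt0Pr => e e0; rewrite add0r.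
have [KT0|K0] := eqVneq (K * T ^+ 2) 0.
  by rewrite (le_trans (Hn 0%N))// KT0 mul0r ltW.
have K1 : 0 < `|K * T ^+ 2| by rewrite normr_gt0.
have [n _ nP] := near_infty_natSinv_lt (PosNum (divr_gt0 e0 K1)).
rewrite (le_trans (Hn n))// (le_trans (ler_norm _))// normrM.
have := nP n (leqnn n); rewrite /= ltr_pdivlMr// => /ltW.
by rewrite mulrC [`|_^-1|]ger0_norm ?invr_ge0.
Qed.


(** The inequality [1 + x <= exp x] used from both endpoints; it plays the part of the mean value
    theorem. *)
Lemma expR_incr {R : realType} (a b : R) : a <= b ->
  expR a * (b - a) <= expR b - expR a <= expR b * (b - a).
Proof.
move=> ab; have ha := expR_ge1Dx (b - a); have hb := expR_ge1Dx (a - b).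
have ea := expR_gt0 a; have eb := expR_gt0 b.
have Ea : expR b = expR a * expR (b - a) by rewrite -expRD; congr expR; ring.
have Eb : expR a = expR b * expR (a - b) by rewrite -expRD; congr expR; ring.
apply/andP; split; first by rewrite Ea; nra.
by rewrite Eb; nra.
Qed.

Lemma integrable_itv_bounded {R : realType} (f : R -> R) (s t c : R) (b : bool) :
  measurable_fun setT f ->
  (forall x, s <= x -> x <= t -> `|f x| <= c) ->
  (@lebesgue_measure R).-integrable [set` Interval (BSide b s) (BRight t)] (EFin \o f).
Proof.
move=> mf fc; apply: measurable_bounded_integrable => //.
- by rewrite /= lebesgue_measure_itv/=; case: ifP => // _; rewrite -EFinB ltry.
- exact: measurable_funTS.
- exists c; split => [|M cM x /= xst]; first exact: num_real.
  rewrite (le_trans _ (ltW cM))// fc//.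
    by case: b xst; rewrite in_itv/= => /andP[]// /ltW.
  by case: b xst; rewrite in_itv/= => /andP[].
Qed.

Lemma le_Rintegral_itv {R : realType} (f g : R -> R) (s t c : R) :
  measurable_fun setT f -> measurable_fun setT g ->
  (forall x, s <= x -> x <= t -> `|f x| <= c) ->
  (forall x, s <= x -> x <= t -> `|g x| <= c) ->
  (forall x, s <= x -> x <= t -> f x <= g x) ->
  \int[@lebesgue_measure R]_(x in `]s, t]) f x <= \int[@lebesgue_measure R]_(x in `]s, t]) g x.
Proof.
move=> mf mg fc gc fg; apply: le_Rintegral => //.
- exact: integrable_itv_bounded fc.
- exact: integrable_itv_bounded gc.
- by move=> x /=; rewrite in_itv/= => /andP[/ltW]; exact: fg.
Qed.

Section occupation.
Context {R : realType} (A : set R) (mA : measurable A).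
Notation mu := (@lebesgue_measure R).
Variable L : R -> R.
Hypothesis LE : forall t, L t = \int[mu]_(s in `[0, t]) (\1_A s : R).

Let A01 x : 0 <= (\1_A x : R) <= 1.
Proof. by rewrite indicE; case: (_ \in _); rewrite /= ?ler01 ?lexx. Qed.

Let mA1 : measurable_fun setT (\1_A : R -> R).
Proof. exact: measurable_indic. Qed.

Let A1n x : `|\1_A x : R| <= 1.
Proof. by have /andP[h0 h1] := A01 x; rewrite ger0_norm. Qed.

Lemma occupationB s t : 0 <= s -> s <= t ->
  L t - L s = \int[mu]_(x in `]s, t]) (\1_A x : R).
Proof.
move=> s0 st; rewrite !LE; apply: Rintegral_itvB; rewrite ?bnd_simp//.
by apply: (integrable_itv_bounded (c := 1)).
Qed.

Lemma occupation_ge0 t : 0 <= L t.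
Proof. by rewrite LE; apply: Rintegral_ge0 => x _. Qed.

Lemma occupation_incr s t : 0 <= s -> s <= t -> 0 <= L t - L s <= t - s.
Proof.
move=> s0 st; rewrite occupationB//.
rewrite Rintegral_ge0//=.
have -> : t - s = \int[mu]_(x in `]s, t]) (cst 1 x : R).
  rewrite Rintegral_cst//= lebesgue_measure_itv/= lte_fin.
  case: ltP => [_|ts]; first by rewrite mul1r.
  by rewrite (le_anti (introT andP (conj st ts))) subrr mulr0.
apply: (@le_Rintegral_itv _ _ _ _ _ 1) => //.
  by move=> x _ _; rewrite normr1.
by move=> x _ _; have /andP[] := A01 x.
Qed.

Lemma occupation_lt0 t : t < 0 -> L t = 0.
Proof.
by move=> t0; rewrite LE set_itv_ge ?Rintegral_set0// -leNgt bnd_simp.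
Qed.

Lemma occupation0 : L 0 = 0.
Proof. by rewrite LE set_itv1 Rintegral_set1. Qed.

Lemma occupation_nd : {homo L : s t / s <= t}.
Proof.
move=> s t st; have [s0|s0] := leP 0 s.
  by rewrite -subr_ge0; have /andP[] := occupation_incr s0 st.
by rewrite occupation_lt0 ?occupation_ge0.
Qed.

Lemma occupation_le t : 0 <= t -> L t <= t.
Proof.
by move=> t0; have := occupation_incr (lexx 0) t0; rewrite occupation0 !subr0 => /andP[].
Qed.

Lemma measurable_occupation : measurable_fun setT L.
Proof. by apply: nondecreasing_measurable => // s t; exact: occupation_nd. Qed.

Variable k : R.
Hypothesis k0 : 0 <= k.

Let E s := expR (k * L s).

Let E_nd : {homo E : s t / s <= t}.
Proof. by move=> s t st; rewrite ler_expR ler_wpM2l// occupation_nd. Qed.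

Let mE : measurable_fun setT E.
Proof.
apply: measurableT_comp => //; apply: measurable_funM => //.
exact: measurable_occupation.
Qed.

Variable I : R -> R.
Hypothesis IE : forall t, I t = \int[mu]_(s in `[0, t]) (E s * \1_A s).

Let mEA : measurable_fun setT (fun s => E s * \1_A s).
Proof. exact: measurable_funM. Qed.

Let EAn t x : x <= t -> `|E x * \1_A x| <= E t.
Proof.
move=> xt; rewrite normrM ger0_norm ?expR_ge0// -[leRHS]mulr1.
apply: ler_pM; [exact: expR_ge0|exact: normr_ge0|exact: E_nd|exact: A1n].
Qed.

Let cAn (c x : R) : 0 <= c -> `|c * \1_A x| <= c.
Proof. by move=> c0; rewrite normrM ger0_norm// ler_piMr. Qed.

(** On []s, t]] the nondecreasing weight [E] lies between its two end values. *)
Let I_incr s t : 0 <= s -> s <= t ->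
  E s * (L t - L s) <= I t - I s <= E t * (L t - L s).
Proof.
move=> s0 st; rewrite occupationB//.
have -> : I t - I s = \int[mu]_(x in `]s, t]) (E x * \1_A x).
  rewrite !IE; apply: Rintegral_itvB; rewrite ?bnd_simp//.
  by apply: (integrable_itv_bounded (c := E t)) => // x _; exact: EAn.
have ZE c : c * \int[mu]_(x in `]s, t]) (\1_A x : R) =
    \int[mu]_(x in `]s, t]) (c * \1_A x).
  by rewrite RintegralZl//; apply: (integrable_itv_bounded (c := 1)).
rewrite ZE ZE.
apply/andP; split.
  apply: (@le_Rintegral_itv _ _ _ _ _ (E t)).
  - exact: measurable_funM.
  - exact: mEA.
  - move=> x _ _; apply: le_trans (cAn _ _) _; first exact: expR_ge0.
    exact: E_nd.
  - by move=> x _; exact: EAn.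
  - move=> x sx _; apply: ler_wpM2r; last exact: E_nd.
    by have /andP[] := A01 x.
apply: (@le_Rintegral_itv _ _ _ _ _ (E t)).
- exact: mEA.
- exact: measurable_funM.
- by move=> x _; exact: EAn.
- by move=> x _ _; apply: cAn; exact: expR_ge0.
- move=> x _ xt; apply: ler_wpM2r; last exact: E_nd.
  by have /andP[] := A01 x.
Qed.

Let D t := E t - k * I t.

(** With [l = L t - L s], both [E t - E s] and [k (I t - I s)] lie between [k l E s] and [k l E t].
    They differ by at most [(E t - E s) k l <= E t (k l)^2], and [l <= t - s]. *)
Let D_incr s t T : 0 <= s -> s <= t -> t <= T ->
  `|D t - D s| <= k ^+ 2 * expR (k * T) * (t - s) ^+ 2.
Proof.
move=> s0 st tT.
have /andP[l1 l2] := occupation_incr s0 st.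
have /andP[i1 i2] := I_incr s0 st.
have kl : k * L s <= k * L t by rewrite ler_wpM2l// occupation_nd.
have /andP[e1 e2] := expR_incr kl.
have eT : E t <= expR (k * T).
  rewrite ler_expR ler_wpM2l// (le_trans _ tT)// occupation_le//.
  exact: le_trans st.
rewrite /D; move: i1 i2 e1 e2 l1 l2 eT (expR_ge0 (k * L t)); rewrite /E.
move: (expR (k * L s)) (expR (k * L t)) (expR (k * T)) (I s) (I t) => a b e i j.
have -> : k * L t - k * L s = k * (L t - L s) by ring.
move: (L t - L s) (t - s) k0 => l u h i1 i2 e1 e2 l1 l2 be b0.
have kl0 : 0 <= k * l by rewrite mulr_ge0.
have -> : b - k * j - (a - k * i) = (b - a) - k * (j - i) by ring.
have H1 : `|b - a - k * (j - i)| <= (b - a) * (k * l).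
  by rewrite ler_norml; apply/andP; split; nra.
apply: (le_trans H1).
have H2 : (b - a) * (k * l) <= b * (k * l) * (k * l) by rewrite ler_wpM2r.
apply: (le_trans H2).
have H3 : (k * l) ^+ 2 <= (k * u) ^+ 2.
  by rewrite lerXn2r ?nnegrE ?mulr_ge0 ?ler_wpM2l// (le_trans l1).
rewrite (_ : b * _ * _ = b * (k * l) ^+ 2); last by ring.
rewrite (_ : k ^+ 2 * _ * _ = e * (k * u) ^+ 2); last by ring.
by rewrite ler_pM// sqr_ge0.
Qed.

(* D has increments of second order, hence is constant; no differentiability
   of L is needed. *)
Lemma expR_occupation t : 0 <= t ->
  expR (k * L t) = 1 + k * \int[mu]_(s in `[0, t]) (expR (k * L s) * \1_A s).
Proof.
move=> t0; have := quadratic_increment_cst t0 (fun a b => @D_incr a b t).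
rewrite -[X in 1 + k * X]/(\int[mu]_(s in `[0, t]) (E s * \1_A s)) -IE.
have I0 : I 0 = 0 by rewrite IE set_itv1 Rintegral_set1.
rewrite /D /E occupation0 I0 !mulr0 expR0 subr0 => /eqP.
by rewrite subr_eq => /eqP ->.
Qed.

End occupation.

(** * The Markov property *)

Section generic.
Local Open Scope ereal_scope.

Lemma integral_indicM {R : realType} d (T : measurableType d)
    (m : {measure set T -> \bar R}) (D : set T) (f : T -> \bar R) :
  \int[m]_(x in D) f x = \int[m]_x ((\1_D x)%:E * f x).
Proof.
rewrite integral_mkcond; apply: eq_integral => x _.
by rewrite patchE indicE; case: (x \in D); rewrite ?mul1e ?mul0e.
Qed.

(** The variable endpoint is moved into the integrand as an indicator, so that Tonelli measurability
    applies. It serves twice: for the given sigma-algebra on [T], and for the one generated by the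
    history. *)
Lemma measurable_occupation_joint {R : realType} d (T : measurableType d)
    (E : set (T * R)) : measurable E ->
  measurable_fun setT (fun z : T * R =>
    \int[@lebesgue_measure R]_(s in `[0%R, z.2]) (\1_(xsection E z.1) s : R))%R.
Proof.
move=> mE; apply: measurableT_comp; first exact: fine_measurable.
pose F (u : (T * R) * R) : \bar R := (\1_[set u : (T * R) * R |
  (0 <= u.2)%R /\ (u.2 <= u.1.2)%R] u * \1_E (u.1.1, u.2))%:E.
rewrite [X in measurable_fun _ X](_ : _ = fubini_F (@lebesgue_measure R) F).
  apply: measurable_fun_fubini_tonelli_F => [|u]; last by rewrite lee_fin mulr_ge0.
  apply/measurable_EFinP; apply: measurable_funM.
    apply: measurable_indic; apply: measurableI.
      rewrite -[X in measurable X]setTI.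
      apply: (measurable_fun_le (f := cst 0%R) (g := snd)) => //.
    rewrite -[X in measurable X]setTI.
    apply: (measurable_fun_le (f := snd) (g := snd \o fst)) => //.
    exact: measurableT_comp.
  apply: (measurableT_comp (measurable_indic mE)).
  apply: measurable_fun_pair => //.
  exact: measurableT_comp.
apply/funext => -[w t]; rewrite integral_indicM; apply: eq_integral => s _ /=.
rewrite /F -EFinM !indicE; congr ((nat_of_bool _)%:R * (nat_of_bool _)%:R)%:E.
  by apply/idP/idP; rewrite !inE/= in_itv/= => /andP.
by rewrite mem_xsection.
Qed.

(** Layer-cake formula: for [x >= 0], the variable [Z * \1_B] exceeds [x] exactly on [{Z > x}]
    intersected with [B]. It turns a random weight into events, the form in which the Markov
    property is given. *)
Lemma integral_tail {R : realType} d (T : measurableType d)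
    (P : probability T R) (Z : T -> R) (B : set T) :
  measurable_fun setT Z -> (forall w, (0 <= Z w)%R) -> measurable B ->
  \int[P]_w (Z w * \1_B w)%:E =
  \int[@lebesgue_measure R]_(x in `[0%R, +oo[) P ([set w | x < Z w]%R `&` B).
Proof.
move=> mZ Z0 mB.
have mf : measurable_fun setT (fun w => Z w * \1_B w : R)%R.
  by apply: measurable_funM => //; exact: measurable_indic.
pose mixin := isMeasurableFun.Build _ _ _ _ _ mf.
pose Y : {mfun T >-> R} := HB.pack (fun w => Z w * \1_B w : R)%R mixin.
rewrite -[LHS](@expectation_def _ _ _ P Y) ge0_expectation_ccdf; last first.
  by move=> x; rewrite mulr_ge0.
apply: eq_integral => x; rewrite inE/= in_itv/= andbT => x0.
rewrite /ccdf /distribution /pushforward/=; congr (P _).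
apply/seteqP; split => w /=; rewrite in_itv/= andbT indicE.
  have [wB|wB] := boolP (w \in B); rewrite ?mulr1 ?mulr0 => xZ.
    by split => //; rewrite inE in wB.
  by rewrite ltNge x0 in xZ.
by move=> [xZ /mem_set ->]; rewrite mulr1.
Qed.

End generic.

Section chain.
Context (R : realType) (S : countType) d (T : measurableType d)
  (X : R -> T -> S) (P : S -> probability T R) (hX : markov_chain X P) (i : S).
Notation mu := (@lebesgue_measure R).

Lemma history_measurable s A : 0 <= s -> history X s A -> measurable A.
Proof.
move=> s0; apply: smallest_sub; first exact: sigma_algebra_measurable.
move=> B [u /=]; rewrite in_itv/= => /andP[u0 _] [C _ <-]; rewrite setTI.
(* As [S] is countable, any event on [X u] is a countable union of the events [state_at X u j]. *)
rewrite (_ : _ @^-1` _ = \bigcup_(j : S) (if `[<C j>] then state_at X u j else set0)).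
  apply: countable_bigcupT_measurable; first exact: countableP.
  by move=> j; case: asboolP => // _; exact: (mc_measurable hX).
apply/seteqP; split => [w /= Cw|w [j _] /=].
  by exists (X u w) => //; rewrite asboolT.
by case: asboolP => // Cj; rewrite /state_at/= => ->.
Qed.

Lemma history_state_at s u j : 0 <= u -> u <= s -> history X s (state_at X u j).
Proof.
move=> u0 us; apply: sub_sigma_algebra; exists u; first by rewrite /= in_itv/= u0.
by exists [set j] => //; rewrite setTI.
Qed.

(** Negative times are sent to 0, as [X] carries meaning only at nonnegative times; the clamped path
    is right-continuous on the whole line. *)
Definition visits : set (T * R) := [set z | X (Num.max z.2 0) z.1 = i].

(** Covers two clamps at once: [u = +oo] gives the path of [visits], and a finite [u] gives the path
    stopped at time [u]. *)
Lemma clamp_right_continuous (u : \bar R) (t : R) w : (0 <= u)%E ->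
  \forall s \near t^'+,
    X (if (s%:E <= u)%E then Num.max s 0 else fine u) w =
    X (if (t%:E <= u)%E then Num.max t 0 else fine u) w.
Proof.
move=> u0; have rgt := nbhs_right_gt t; have [tu|ut] := ltP t%:E u; last first.
  apply: filterS rgt => s ts; have su : (s%:E <= u)%E = false.
    by apply/negbTE; rewrite -ltNge (le_lt_trans ut)// lte_fin.
  rewrite su; case: ifPn => // tu.
  have uE : u = t%:E by apply/le_anti/andP.
  by rewrite uE/= max_l// -lee_fin -uE.
have su : \forall s \near t^'+, (s%:E <= u)%E.
  case: u tu u0 => [u|_ _|//]; last by apply: filterS rgt => s _; rewrite leey.
  by rewrite lte_fin => /nbhs_right_lt + _; apply: filterS => s /ltW; rewrite lee_fin.
rewrite (ltW tu); have [t0|t0] := leP 0 t.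
  have rc := mc_right_continuous hX w t0.
  apply: filterS3 su rgt rc => s -> ts <-.
  by rewrite max_l// (le_trans t0)// ltW.
have sl0 := nbhs_right_lt t0.
by apply: filterS2 su sl0 => s -> /ltW s0; rewrite max_r.
Qed.

Lemma measurable_visits : measurable visits.
Proof.
apply: (measurable_right_continuous (A := fun t => state_at X (Num.max t 0) i)).
  by move=> t; apply: (mc_measurable hX); rewrite le_max lexx orbT.
move=> t w; have := clamp_right_continuous t w (leey 0).
apply: filterS => s; rewrite !leey => Xst.
by rewrite /state_at/= Xst.
Qed.

Lemma local_timeE w t :
  local_time X i t w = \int[mu]_(s in `[0, t]) (\1_(xsection visits w) s : R).
Proof.
apply: eq_Rintegral => s; rewrite inE/= in_itv/= => /andP[s0 _].
rewrite !indicE; congr (nat_of_bool _)%:R.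
rewrite mem_xsection.
by apply/idP/idP; rewrite !inE /visits/= max_l.
Qed.

Lemma measurable_local_time_joint :
  measurable_fun setT (fun z : T * R => local_time X i z.2 z.1).
Proof.
under eq_fun do rewrite local_timeE.
exact: measurable_occupation_joint measurable_visits.
Qed.

(* Freezing the path at time [s] does not change the local time up to [s] and
   makes it adapted to the history at time [s]. *)
Lemma history_local_time s x : 0 <= s ->
  history X s [set w | x < local_time X i s w].
Proof.
move=> s0; pose G := \bigcup_(u in `[0, s]) preimage_set_system setT (X u) setT.
pose T' := g_sigma_algebraType G.
pose E : set (T' * R) :=
  [set z | X (if (z.2%:E <= s%:E)%E then Num.max z.2 0 else s) z.1 = i].
have mE : measurable E.
  apply: (measurable_right_continuous (A := fun t =>
      state_at X (if (t%:E <= s%:E)%E then Num.max t 0 else s) i : set T')).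
    move=> t; apply: history_state_at.
      by case: ifP => _ //; rewrite le_max lexx orbT.
    by rewrite lee_fin; case: ifPn => [ts|_//]; rewrite ge_max ts.
  move=> t w.
  have s0' : (0 <= s%:E)%E by rewrite lee_fin.
  have := clamp_right_continuous t w s0'.
  by apply: filterS => v Xvt; rewrite /state_at/= Xvt.
have mL : measurable_fun (setT : set T') (fun w : T' => local_time X i s w).
  rewrite (_ : (fun w => _) = (fun z : T' * R =>
    \int[mu]_(v in `[0, z.2]) (\1_(xsection E z.1) v : R)) \o (fun w => (w, s))).
    apply: measurableT_comp; first exact: measurable_occupation_joint.
    exact: pair2_measurable.
  apply/funext => w /=; apply: eq_Rintegral => v; rewrite inE/= in_itv/= => /andP[v0 vs].
  rewrite !indicE; congr (nat_of_bool _)%:R.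
  rewrite mem_xsection.
  by apply/idP/idP; rewrite !inE /E/= lee_fin vs max_l.
have := mL measurableT `]x, +oo[%classic (measurable_itv _).
rewrite setTI; rewrite (_ : _ @^-1` _ = [set w | x < local_time X i s w])//.
by apply/seteqP; split => w /=; rewrite in_itv/= andbT.
Qed.

(** By the layer-cake formula it suffices to treat the events [{Z > x}], which lie in the history at
    time [s]; there the Markov property applies, and the transition probability leaves the integral
    over [x]. *)
Lemma markov_integral (Z : T -> R) s t : 0 <= s -> 0 <= t ->
  (forall w, 0 <= Z w) -> (forall x, history X s [set w | x < Z w]) ->
  (\int[P i]_w (Z w * \1_(state_at X s i `&` state_at X (s + t) i) w)%:E =
   (\int[P i]_w (Z w * \1_(state_at X s i) w)%:E) * (trans_prob X P t i i)%:E)%E.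
Proof.
move=> s0 t0 Z0 hZ.
have mZ : measurable_fun setT Z.
  apply: (measurability (@RGenOInfty.G R)); first exact: RGenOInfty.measurableE.
  move=> /= _ [_ [x ->] <-]; rewrite setTI.
  rewrite (_ : _ @^-1` _ = [set w | x < Z w]); first exact: history_measurable (hZ x).
  by apply/seteqP; split => w /=; rewrite in_itv/= andbT.
have mS u : 0 <= u -> measurable (state_at X u i) by move=> u0; exact: (mc_measurable hX).
have mSt := mS _ s0; have mSst := mS _ (addr_ge0 s0 t0).
rewrite integral_tail//; last exact: measurableI.
rewrite integral_tail// -ge0_integralZr//.
- by apply: eq_integral => x _; rewrite setIA (mc_markov hX).
(* The tail probability is measurable in [x] because it is nonincreasing. *)
- have mI (x : R) := mZ measurableT `]x, +oo[%classic (measurable_itv _).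
  apply: measurable_funTS.
  have : {homo (fun x : R => fine (P i ([set w | x < Z w] `&` state_at X s i))) : x y /~ x <= y}.
    move=> x y xy; apply: fine_le; rewrite ?fin_num_measure//.
    - by apply: measurableI => //; apply: history_measurable (hZ _).
    - by apply: measurableI => //; apply: history_measurable (hZ _).
    - apply: le_measure; rewrite ?inE.
      + by apply: measurableI => //; apply: history_measurable (hZ _).
      + by apply: measurableI => //; apply: history_measurable (hZ _).
      + by apply: setSI => w /=; exact: le_lt_trans.
  move=> ni; have : measurable_fun [set: R]
      (fun x : R => fine (P i ([set w | x < Z w] `&` state_at X s i))).
    by apply: nonincreasing_measurable => // x y; exact: ni.
  move=> /measurable_EFinP.
  apply: eq_measurable_fun => x _ /=; rewrite fineK// fin_num_measure//.
  by apply: measurableI => //; apply: history_measurable (hZ _).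
- by rewrite lee_fin fine_ge0.
Qed.

End chain.

(** * The renewal equation *)

Section causal.
Context {R : realType}.
Notation mu := (@lebesgue_measure R).
Local Open Scope ereal_scope.

Definition causal (f : R -> \bar R) := forall s, (s < 0)%R -> f s = 0.

Lemma convE_causal (f g : R -> \bar R) t : causal f -> causal g ->
  conv f g t = \int[mu]_(s in `[0%R, t]) (f s * g (t - s)%R).
Proof.
move=> cf cg; rewrite /conv [RHS]integral_mkcond; apply: eq_integral => s _.
rewrite patchE; case: ifPn => //; rewrite notin_setE/= in_itv/= => /negP.
rewrite negb_and -!ltNge => /orP[s0|ts]; first by rewrite cf// mul0e.
by rewrite cg ?mule0// subr_lt0.
Qed.

Lemma conv_causal (f g : R -> \bar R) : causal f -> causal g -> causal (conv f g).
Proof.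
move=> cf cg t t0; rewrite convE_causal// set_itv_ge ?integral_set0//.
by rewrite -leNgt bnd_simp.
Qed.

(** The constant 1 of the renewal calculus: convolving a causal function with it integrates that
    function over [[0, t]]. *)
Definition heaviside (t : R) : \bar R := (\1_(`[0%R, +oo[%classic : set R) t)%:E.

Lemma heaviside1 t : (0 <= t)%R -> heaviside t = 1.
Proof. by move=> t0; rewrite /heaviside indicE mem_set//= in_itv/= t0. Qed.

Lemma heaviside_causal : causal heaviside.
Proof.
by move=> t t0; rewrite /heaviside indicE memNset//= in_itv/= andbT leNgt t0.
Qed.

Lemma heaviside_ge0 t : 0 <= heaviside t.
Proof. by rewrite lee_fin. Qed.

Lemma measurable_heaviside : measurable_fun setT heaviside.
Proof. by apply/measurable_EFinP; exact: measurable_indic. Qed.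

Lemma conv_heaviside (f : R -> \bar R) t : causal f ->
  conv f heaviside t = \int[mu]_(s in `[0%R, t]) f s.
Proof.
move=> cf; rewrite convE_causal//; last exact: heaviside_causal.
apply: eq_integral => s; rewrite inE/= in_itv/= => /andP[s0 st].
by rewrite heaviside1 ?mule1// subr_ge0.
Qed.

End causal.
#[global] Hint Resolve heaviside_causal heaviside_ge0 : core.

Section renewal.
Context (R : realType) (S : countType) d (T : measurableType d)
  (X : R -> T -> S) (P : S -> probability T R) (hX : markov_chain X P) (i : S)
  (k : R) (k0 : 0 <= k).
Notation mu := (@lebesgue_measure R).
Local Open Scope ereal_scope.

(** The functions [p] and, next, [M] of the overview. The factor [heaviside] discards negative
    times, where [X] is unconstrained. *)
Definition return_prob (t : R) : \bar R := heaviside t * (trans_prob X P t i i)%:E.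

Definition moment (t : R) : \bar R := heaviside t * exp_moment X P k i t.

Let Y (w : T) (t : R) : R := expR (k * local_time X i t w).

Let Y_ge0 w t : (0 <= Y w t)%R. Proof. exact: expR_ge0. Qed.

Let mY : measurable_fun setT (fun z : T * R => Y z.1 z.2).
Proof.
apply: measurableT_comp => //; apply: measurable_funM => //.
exact: (measurable_local_time_joint hX).
Qed.

Let LE w t := @local_timeE R S d T X i w t.

Let mA w : measurable (xsection (visits X i) w).
Proof. by apply: measurable_xsection; exact: (measurable_visits hX). Qed.

Let E (t : R) : set T := [set w | visits X i (w, t)].

Let mE t : measurable (E t).
Proof.
rewrite (_ : E t = ysection (visits X i) t); last first.
  by apply/seteqP; split => w; rewrite /ysection/= inE.
by apply: measurable_ysection; exact: (measurable_visits hX).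
Qed.

Let EE t : (0 <= t)%R -> E t = state_at X t i.
Proof. by move=> t0; apply/seteqP; split => w; rewrite /E/visits/= max_l. Qed.

Let trans_probE t : (0 <= t)%R -> (trans_prob X P t i i)%:E = P i (E t).
Proof. by move=> t0; rewrite /trans_prob EE// fineK// fin_num_measure// -EE. Qed.

Let W (w : T) (t : R) : R := (Y w t * \1_(E t) w)%R.

Let W_ge0 w t : (0 <= W w t)%R. Proof. by rewrite mulr_ge0. Qed.

Let mW : measurable_fun setT (fun z : T * R => W z.1 z.2).
Proof.
apply: measurable_funM => //.
rewrite (_ : (fun z => _) = \1_(visits X i)).
  by apply: measurable_indic; exact: (measurable_visits hX).
by apply/funext => -[w t]; rewrite !indicE; congr (nat_of_bool _)%:R;
  apply/idP/idP; rewrite !inE.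
Qed.

Let pathwise w t : (0 <= t)%R ->
  (Y w t)%:E = 1 + k%:E * \int[mu]_(s in `[0%R, t]) (W w s)%:E.
Proof.
move=> t0.
rewrite /Y (expR_occupation (mA w) (LE w) k0 (fun=> erefl) t0) EFinD EFinM.
congr (_ + _ * _).
rewrite /Rintegral fineK.
  apply: eq_integral => s _; rewrite /W /Y !indicE mem_xsection; congr (_ * (nat_of_bool _)%:R)%:E.
have Lnd := occupation_nd (mA w) (LE w).
apply: integrable_fin_num => //.
apply: (@integrable_itv_bounded _ _ _ _ (expR (k * local_time X i t w)) true).
  apply: measurable_funM; last exact: measurable_indic.
  apply: measurableT_comp => //; apply: measurable_funM => //.
  exact: (measurable_occupation (mA w) (LE w)).
move=> s _ st; rewrite normrM ger0_norm ?expR_ge0//.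
have A1 : (`|\1_(xsection (visits X i) w) s : R| <= 1)%R.
  by rewrite indicE; case: (_ \in _); rewrite ?normr1 ?normr0.
apply: le_trans (ler_piMr (expR_ge0 _) A1) _.
by rewrite ler_expR ler_wpM2l// Lnd.
Qed.

(** The pathwise identity integrated over an event, by Tonelli. The whole space yields
    [M = 1 + k q * 1]; the event [{X_t = i}] leads to the equation for [q]. *)
Let integrated t (B : set T) : (0 <= t)%R -> measurable B ->
  \int[P i]_w (Y w t * \1_B w)%:E = P i B +
    k%:E * \int[mu]_(s in `[0%R, t]) \int[P i]_w (W w s * \1_B w)%:E.
Proof.
move=> t0 mB.
have mB1 : measurable_fun setT (\1_B : T -> R) by exact: measurable_indic.
pose F (z : T * R) := (\1_(`[0%R, t]%classic : set R) z.2 * (W z.1 z.2 * \1_B z.1))%:E.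
have mF : measurable_fun setT F.
  apply/measurable_EFinP; apply: measurable_funM.
    by apply: (measurableT_comp (measurable_indic _)) => //; exact: measurable_itv.
  by apply: measurable_funM => //; exact: measurableT_comp.
have F0 z : 0 <= F z by rewrite lee_fin !mulr_ge0.
transitivity (\int[P i]_w ((\1_B w)%:E + k%:E * \int[mu]_s F (w, s))).
  apply: eq_integral => w _; rewrite EFinM pathwise// ge0_muleDl//; last first.
    apply: mule_ge0 => //; apply: integral_ge0 => s _; rewrite lee_fin//.
  rewrite mul1e -muleA; congr (_ + _ * _).
  rewrite integral_indicM -ge0_integralZr//.
  - by apply: eq_integral => s _; rewrite /F -!EFinM -mulrA.
  - apply: emeasurable_funM.
      by apply/measurable_EFinP; exact: measurable_indic.
    apply/measurable_EFinP.
    exact: (measurable_fun_pair2 (f := fun z => W z.1 z.2) w mW).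
  - by move=> s _; rewrite mule_ge0// lee_fin.
have mG : measurable_fun setT (fun w => \int[mu]_s F (w, s)).
  exact: measurable_fun_fubini_tonelli_F.
have G0 w : 0 <= \int[mu]_s F (w, s) by apply: integral_ge0 => s _.
rewrite ge0_integralD//; last 3 first.
- exact/measurable_EFinP.
- by move=> w _; rewrite mule_ge0.
- exact: measurable_funeM.
congr (_ + _); first by rewrite integral_indic// setIT.
rewrite ge0_integralZl//; congr (_ * _).
rewrite (fubini_tonelli (m1 := P i) (m2 := mu) F mF F0).
rewrite [RHS]integral_indicM; apply: eq_integral => s _.
rewrite -ge0_integralZl//.
- apply/measurable_EFinP; apply: measurable_funM => //.
  exact: (measurable_fun_pair1 (f := fun z => W z.1 z.2) s mW).
- by move=> w _; rewrite lee_fin mulr_ge0.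
Qed.

Let q (t : R) : \bar R := heaviside t * \int[P i]_w (W w t)%:E.

Let q_ge0 t : 0 <= q t.
Proof.
by rewrite mule_ge0//; apply: integral_ge0 => w _; rewrite lee_fin.
Qed.

Let q_causal : causal q.
Proof. by move=> t t0; rewrite /q heaviside_causal// mul0e. Qed.

Let mq : measurable_fun setT q.
Proof.
apply: emeasurable_funM; first exact: measurable_heaviside.
have mWE : measurable_fun setT (fun z : T * R => (W z.1 z.2)%:E).
  exact/measurable_EFinP.
have W0 (z : T * R) : 0 <= (W z.1 z.2)%:E by rewrite lee_fin.
exact: (measurable_fun_fubini_tonelli_G (m1 := P i) _ mWE W0).
Qed.

Lemma return_prob_ge0 t : 0 <= return_prob t.
Proof. by rewrite mule_ge0// lee_fin fine_ge0. Qed.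

Lemma return_prob_causal : causal return_prob.
Proof. by move=> t t0; rewrite /return_prob heaviside_causal// mul0e. Qed.

Lemma measurable_return_prob : measurable_fun setT return_prob.
Proof.
rewrite (_ : return_prob = fun t => heaviside t * P i (ysection (visits X i) t)).
  apply: emeasurable_funM; first exact: measurable_heaviside.
  apply: measurable_fun_ysection; exact: (measurable_visits hX).
apply/funext => t; rewrite /return_prob.
have [t0|t0] := ltP t 0%R; first by rewrite heaviside_causal// !mul0e.
rewrite trans_probE//; congr (_ * P i _).
by apply/seteqP; split => w; rewrite /ysection/= inE.
Qed.
Hint Resolve return_prob_ge0 return_prob_causal measurable_return_prob : core.

Let momentE t : (0 <= t)%R -> moment t = \int[P i]_w (Y w t)%:E.
Proof. by move=> t0; rewrite /moment heaviside1// mul1e /exp_moment unlock. Qed.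

Lemma moment_causal : causal moment.
Proof. by move=> t t0; rewrite /moment heaviside_causal// mul0e. Qed.

Let moment_q t : moment t = heaviside t + k%:E * conv q heaviside t.
Proof.
have [t0|t0] := ltP t 0%R.
  rewrite moment_causal// heaviside_causal// conv_causal// ?mule0 ?adde0//.
rewrite momentE// heaviside1//.
transitivity (\int[P i]_w (Y w t * \1_(setT : set T) w)%:E).
  by apply: eq_integral => w _; rewrite indicE in_setT mulr1.
rewrite integrated// probability_setT conv_heaviside//; congr (_ + _ * _).
apply: eq_integral => s; rewrite inE/= in_itv/= => /andP[s0 _].
rewrite /q heaviside1// mul1e; apply: eq_integral => w _.
by rewrite indicE in_setT mulr1.
Qed.

(** For [k > 0] and [x > 0] this is the event [{L_s > ln x / k}]; otherwise it is empty or the whole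
    space. *)
Let history_Y s x : (0 <= s)%R -> history X s [set w | (x < Y w s)%R].
Proof.
move=> s0; have [kz|kn0] := eqVneq k 0%R.
  have [x1|x1] := ltP x 1%R.
    rewrite (_ : [set w | _] = setT).
      by rewrite -setC0; apply: sigma_algebraC; exact: sigma_algebra0.
    by apply/seteqP; split => // w _ /=; rewrite /Y kz mul0r expR0.
  rewrite (_ : [set w | _] = set0); first exact: sigma_algebra0.
  by apply/seteqP; split => // w /=; rewrite /Y kz mul0r expR0 ltNge x1.
have kgt0 : (0 < k)%R by rewrite lt_neqAle eq_sym kn0.
have [x0|x0] := leP x 0%R.
  rewrite (_ : [set w | _] = setT).
    by rewrite -setC0; apply: sigma_algebraC; exact: sigma_algebra0.
  by apply/seteqP; split => // w _ /=; rewrite (le_lt_trans x0)// expR_gt0.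
rewrite (_ : [set w | _] = [set w | ln x / k < local_time X i s w]%R).
  exact: (history_local_time hX).
apply/seteqP; split => w /=; rewrite /Y ltr_pdivrMr// -(ltr_expR (ln x))
  lnK ?posrE// mulrC//.
Qed.

Let q_renewal t : q t = return_prob t + k%:E * conv q return_prob t.
Proof.
have [t0|t0] := ltP t 0%R.
  by rewrite q_causal// return_prob_causal// conv_causal// ?mule0 ?adde0//.
rewrite /q heaviside1// mul1e integrated// -trans_probE//.
rewrite /return_prob heaviside1// mul1e convE_causal//; congr (_ + _ * _).
apply: eq_integral => s; rewrite inE/= in_itv/= => /andP[s0 st].
have ts0 : (0 <= t - s)%R by rewrite subr_ge0.
rewrite /q /return_prob !heaviside1// !mul1e.
transitivity (\int[P i]_w (Y w s * \1_(state_at X s i `&` state_at X (s + (t - s)) i) w)%:E).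
  by apply: eq_integral => w _; rewrite indicI addrC subrK -!EE//= mulrA.
rewrite (markov_integral hX)//; last by move=> x; exact: history_Y.
by rewrite -EE.
Qed.

Lemma moment_ge0 t : 0 <= moment t.
Proof. by rewrite moment_q adde_ge0// mule_ge0// conv_ge0. Qed.

Lemma measurable_moment : measurable_fun setT moment.
Proof.
rewrite (_ : moment = fun t => heaviside t + k%:E * conv q heaviside t).
  apply: emeasurable_funD; first exact: measurable_heaviside.
  by apply: measurable_funeM; apply: measurable_conv => //; exact: measurable_heaviside.
by apply/funext => t; exact: moment_q.
Qed.

Lemma moment_nd s t : (s <= t)%R -> moment s <= moment t.
Proof.
move=> st; have [s0|s0] := ltP s 0%R.
  by rewrite moment_causal// moment_ge0.
have t0 : (0 <= t)%R by exact: le_trans st.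
rewrite (momentE s0) (momentE t0).
apply: ge0_le_integral; first exact: measurableT.
- by move=> w _; rewrite lee_fin.
- by apply/measurable_EFinP; exact: (measurable_fun_pair1 s mY).
- by apply/measurable_EFinP; exact: (measurable_fun_pair1 t mY).
- move=> w _; rewrite lee_fin ler_expR ler_wpM2l//.
  exact: (occupation_nd (mA w) (LE w)).
Qed.

(** From [L_t <= t]. The crude bound serves to make [M] finite, so that terms may be cancelled. *)
Lemma moment_le t : (0 <= t)%R -> moment t <= (expR (k * t))%:E.
Proof.
move=> t0; rewrite momentE//.
apply: (@le_trans _ _ (\int[P i]_w (cst (expR (k * t))%:E w))); last first.
  by rewrite integral_cst// [X in _ * X](_ : _ = 1) ?mule1//; exact: probability_setT.
apply: ge0_le_integral; first exact: measurableT.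
- by move=> w _; rewrite lee_fin.
- by apply/measurable_EFinP; exact: (measurable_fun_pair1 t mY).
- exact: measurable_cst.
- move=> w _; rewrite lee_fin ler_expR ler_wpM2l//.
  exact: (occupation_le (mA w) (LE w)).
Qed.

(** Substituting [M = 1 + k q * 1] gives [k p * M = k (p + k q * p) * 1], and the bracket is [q] by
    its own renewal equation. *)
Lemma moment_renewal t :
  moment t = heaviside t + k%:E * conv return_prob moment t.
Proof.
rewrite moment_q; congr (_ + _ * _).
have mh := @measurable_heaviside R; have mr := measurable_return_prob.
have mqp := measurable_conv mq mr q_ge0 return_prob_ge0.
have mqh := measurable_conv mq mh q_ge0 (@heaviside_ge0 R).
have qE : q = fun t => return_prob t + k%:E * conv q return_prob t.
  by apply/funext => x; exact: q_renewal.
have ME : moment = fun t => heaviside t + k%:E * conv q heaviside t.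
  by apply/funext => x; exact: moment_q.
have c1 x : 0 <= conv q return_prob x by apply: conv_ge0.
have c2 x : 0 <= conv q heaviside x by apply: conv_ge0.
rewrite (convC mr measurable_moment return_prob_ge0 moment_ge0).
rewrite ME convDl//; [|exact: measurable_funeM|by move=> x; rewrite mule_ge0].
rewrite convZl// -convA// (convC mh mr)//.
rewrite [in LHS]qE convDl//; [|exact: measurable_funeM|by move=> x; rewrite mule_ge0].
by rewrite convZl// -convA// (convC mh mr).
Qed.

End renewal.

(** * Integrals of powers *)

Section calculus.
Context {R : realType}.
Notation mu := (@lebesgue_measure R).

Lemma FTC2_pos (f F : R -> R) (x y : R) : 0 < x -> x <= y ->
  (forall z : R, 0 < z -> derivable F z 1) ->
  (forall z : R, 0 < z -> derive1 F z = f z) ->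
  (forall z : R, 0 < z -> {for z, continuous f}) ->
  (\int[mu]_(s in `[x, y]) (f s)%:E = (F y - F x)%:E)%E.
Proof.
move=> x0; rewrite le_eqVlt => /predU1P[<- _ _ _|xy dF dFE cf].
  by rewrite set_itv1 integral_set1 subrr.
have y0 := lt_trans x0 xy.
have cF z : 0 < z -> {for z, continuous F}.
  by move=> z0; apply/differentiable_continuous/derivable1_diffP; exact: dF.
rewrite EFinB; apply: continuous_FTC2 => //.
- apply: continuous_in_subspaceT => z; rewrite inE/= in_itv/= => /andP[xz _].
  exact/cf/(lt_le_trans x0).
- split.
  + by move=> z; rewrite in_itv/= => /andP[xz _]; exact: dF (lt_trans x0 xz).
  + exact/cvg_at_right_filter/cF.
  + exact/cvg_at_left_filter/cF.
- move=> z; rewrite in_itv/= => /andP[xz _]; exact: dFE (lt_trans x0 xz).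
Qed.

Lemma continuous_powR_pos (r z : R) : 0 < z -> {for z, continuous (fun x : R => x `^ r)}.
Proof.
move=> z0; apply/differentiable_continuous/derivable1_diffP.
by apply: derivable_powR; rewrite in_itv/= andbT.
Qed.

Lemma is_derive_powR_primitive (r z : R) : r + 1 != 0 -> 0 < z ->
  is_derive z (1 : R) (fun x => x `^ (r + 1) / (r + 1)) (z `^ r).
Proof.
move=> r0 z0; have dp := @is_derive1_powR R (r + 1) z z0.
have df := is_deriveM dp (@is_derive_cst R _ _ (r + 1)^-1 z (1 : R)).
apply: (is_derive_eq df).
by rewrite scaler0 add0r addrK /GRing.scale/= mulrA mulVf// mul1r.
Qed.

Lemma integral_powR_itv (r x y : R) : r + 1 != 0 -> 0 < x -> x <= y ->
  (\int[mu]_(s in `[x, y]) (s `^ r)%:E =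
   ((y `^ (r + 1) - x `^ (r + 1)) / (r + 1))%:E)%E.
Proof.
move=> r0 x0 xy.
rewrite mulrBl.
apply: (FTC2_pos (F := fun x => x `^ (r + 1) / (r + 1)) x0 xy).
- by move=> z z0; case: (is_derive_powR_primitive r0 z0).
- by move=> z z0; rewrite derive1E; case: (is_derive_powR_primitive r0 z0).
- by move=> z; exact: continuous_powR_pos.
Qed.

Lemma integral_inv_itv (x y : R) : 0 < x -> x <= y ->
  (\int[mu]_(s in `[x, y]) (s^-1)%:E = (ln y - ln x)%:E)%E.
Proof.
move=> x0 xy; rewrite (@FTC2_pos (fun s : R => s^-1) (@ln R) x y x0 xy)//.
- by move=> z z0; case: (is_derive1_ln z0).
- by move=> z z0; rewrite derive1E; case: (is_derive1_ln z0).
- by move=> z z0; apply: inv_continuous; rewrite gt_eqF.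
Qed.

Lemma powR_ge_near (a K : R) : 0 < a -> \forall t \near +oo, K <= t `^ a.
Proof.
move=> a0; near=> t.
have [K0|K0] := leP K 0; first by rewrite (le_trans K0)// powR_ge0.
have -> : K = (K `^ a^-1) `^ a by rewrite -powRrM mulVf ?gt_eqF// powRr1// ltW.
have Kt : K `^ a^-1 <= t by near: t; apply: nbhs_pinfty_ge; exact: num_real.
apply: ge0_ler_powR; rewrite ?nnegrE ?powR_ge0 ?(ltW a0)//.
Unshelve. all: by end_near. Qed.

Lemma powRN_le_near (a e : R) : 0 < a -> 0 < e -> \forall t \near +oo, t `^ (- a) <= e.
Proof.
move=> a0 e0; near=> t.
have et : e^-1 <= t `^ a by near: t; exact: powR_ge_near.
by rewrite powRN -(invrK e) lef_pV2// posrE ?invr_gt0// (lt_le_trans _ et)// invr_gt0.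
Unshelve. all: by end_near. Qed.

Lemma powR_cvg_pinfty (a : R) : 0 < a -> t `^ (- a) @[t --> +oo] --> (0 : R).
Proof.
move=> a0; apply/cvgrPdist_le => e e0.
by have := powRN_le_near a0 e0; apply: filterS => t te; rewrite sub0r normrN ger0_norm ?powR_ge0.
Qed.

Lemma integral_powR_tail (r x : R) : r < -1 -> 0 < x ->
  (\int[mu]_(s in `]x, +oo[) (s `^ r)%:E = (x `^ (r + 1) / (- (r + 1)))%:E)%E.
Proof.
move=> r1 x0; have r10 : r + 1 < 0 by rewrite -ltrBrDr sub0r.
have rn0 : r + 1 != 0 by rewrite lt_eqF.
rewrite integral_itv_obnd_cbnd; last first.
  by apply/measurable_EFinP; apply: measurable_funTS; exact: measurable_powR.
rewrite (@ge0_continuous_FTC2y _ _ (fun x => x `^ (r + 1) / (r + 1)) _ 0).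
- by rewrite sub0e -EFinN invrN mulrN.
- by move=> z _; exact: powR_ge0.
- apply: continuous_in_subspaceT => z; rewrite inE/= in_itv/= andbT => xz.
  by apply: continuous_powR_pos; rewrite (lt_le_trans x0).
- rewrite -(mul0r (r + 1)^-1); apply: cvgMl.
  by rewrite -(opprK (r + 1)); apply: powR_cvg_pinfty; rewrite oppr_gt0.
- by move=> z xz; case: (is_derive_powR_primitive rn0 (lt_trans x0 xz)).
- apply: cvg_at_right_filter.
  have cF : {for x, continuous (fun x : R => x `^ (r + 1) / (r + 1))}.
    apply/differentiable_continuous/derivable1_diffP.
    by case: (is_derive_powR_primitive rn0 x0).
  exact: cF.
- move=> z; rewrite in_itv/= andbT => xz; rewrite derive1E.
  by have [_ ->] := is_derive_powR_primitive rn0 (lt_trans x0 xz).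
Qed.

(** For [a < 1] the integrand is unbounded at 0, so []0, 1]] is exhausted by the intervals
    [[1/(n+1), 1]] and the limit taken by monotone convergence. *)
Lemma integral_powR01 (a : R) : 0 < a ->
  (\int[mu]_(s in `]0%R, 1%R]) (s `^ (a - 1))%:E = a^-1%:E)%E.
Proof.
move=> a0.
have U : \bigcup_n `[n.+1%:R^-1 : R, 1]%classic = `]0, 1]%classic.
  apply/seteqP; split => [x [n _]|x]; rewrite /= !in_itv/= => /andP[x0 x1].
    by rewrite x1 andbT (lt_le_trans _ x0).
  have [n _ nP] := near_infty_natSinv_lt (PosNum x0).
  by exists n => //=; rewrite in_itv/= x1 andbT ltW// nP//=.
have mp D : measurable_fun D (fun s : R => (s `^ (a - 1))%:E).
  by apply/measurable_EFinP; apply: measurable_funTS; exact: measurable_powR.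
rewrite -U.
pose J (n : nat) := (\int[mu]_(s in `[n.+1%:R^-1%R, 1%R]) (s `^ (a - 1))%:E)%E.
have J1 : J n @[n --> \oo] -->
    (\int[mu]_(s in \bigcup_n `[n.+1%:R^-1%R : R, 1%R]%classic) (s `^ (a - 1))%:E)%E.
  apply: ge0_nondecreasing_set_cvg_integral => //.
    apply/nondecreasing_seqP => n; rewrite subsetEset => x /=.
    rewrite !in_itv/= => /andP[x0 ->]; rewrite andbT (le_trans _ x0)//.
    by rewrite lef_pV2 ?posrE// ler_nat.
    by move=> n; exact: mp.
  by move=> n x _; rewrite lee_fin powR_ge0.
have JE : J = (fun n => ((1 - n.+1%:R `^ (- a)) / a)%:E).
  apply/funext => n; rewrite /J integral_powR_itv ?subrK ?gt_eqF//; last first.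
    by rewrite invf_le1// ler1n.
  rewrite powR1; congr (((1 - _) / a)%:E).
  by rewrite -powR_inv1// -powRrM mulN1r.
have J2 : J n @[n --> \oo] --> (a^-1)%:E.
  rewrite (_ : a^-1 = (1 - 0) / a); last by rewrite subr0 mul1r.
  rewrite JE; apply: cvg_EFin; first by near=> n.
  apply: (@cvgM _ _ _ _ (fun n : nat => 1 - n.+1%:R `^ (- a) : R) (cst a^-1));
    last exact: cvg_cst.
  apply: cvgB; first exact: cvg_cst.
  apply: (cvg_comp _ _ _ (powR_cvg_pinfty a0)).
  apply/cvgryPge => K; near=> n; rewrite (@le_trans _ _ n%:R)//; last by rewrite ler_nat.
  by near: n; exact: nbhs_infty_ger.
exact: (cvg_unique _ J1 J2).
Unshelve. all: by end_near. Qed.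

End calculus.

(** * Power kernels and the Gamma function *)

Section power_kernel.
Context {R : realType}.
Notation mu := (@lebesgue_measure R).
Local Open Scope ereal_scope.

(** Indexed as in the Gamma integral, so that indices add under convolution; index 1 is [heaviside],
    index 2 the identity on nonnegative times. *)
Definition power_kernel (a t : R) : \bar R := heaviside t * (t `^ (a - 1))%:E.

Notation kp := power_kernel.

Lemma power_kernel_ge0 a t : 0 <= kp a t.
Proof. by rewrite mule_ge0// lee_fin powR_ge0. Qed.

Lemma power_kernel_causal a : causal (kp a).
Proof. by move=> t t0; rewrite /kp heaviside_causal// mul0e. Qed.

Lemma measurable_power_kernel a : measurable_fun setT (kp a).
Proof.
apply: emeasurable_funM; first exact: measurable_heaviside.
by apply/measurable_EFinP; exact: measurable_powR.
Qed.

Hint Resolve power_kernel_ge0 power_kernel_causal : core.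

Lemma power_kernel_pos a t : (0 <= t)%R -> kp a t = (t `^ (a - 1))%:E.
Proof. by move=> t0; rewrite /kp heaviside1// mul1e. Qed.

Lemma power_kernel1 : kp 1%R = heaviside.
Proof. by apply/funext => t; rewrite /kp subrr powRr0 mule1. Qed.

Lemma power_kernelM a t u : (0 < t)%R -> kp a (t * u)%R = (t `^ (a - 1))%:E * kp a u.
Proof.
move=> t0; have [u0|u0] := ltP u 0%R.
  by rewrite !power_kernel_causal ?mule0// pmulr_rlt0.
by rewrite !power_kernel_pos ?mulr_ge0// ?(ltW t0)// powRM// ltW.
Qed.

(** Substitution [s = t x] in the convolution. The constant [conv (kp a) (kp b) 1] is the Beta
    integral B(a, b). *)
Lemma conv_power_kernel a b t : (0 < t)%R ->
  conv (kp a) (kp b) t = conv (kp a) (kp b) 1%R * (t `^ (a + b - 1))%:E.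
Proof.
move=> t0; rewrite /conv (@integral_scale _ _ t)//; last 2 first.
- by apply: measurable_conv_fun; exact: measurable_power_kernel.
- by move=> x; rewrite mule_ge0.
have -> : (fun x : R => kp a (t * x)%R * kp b (t - t * x)%R) =
    (fun x : R => (t `^ (a - 1) * t `^ (b - 1))%:E * (kp a x * kp b (1 - x)%R)).
  apply/funext => x; rewrite (_ : t - t * x = t * (1 - x))%R; last by ring.
  by rewrite !power_kernelM// EFinM muleACA.
rewrite ge0_integralZl//.
- rewrite muleA -EFinM muleC; congr (_ * _%:E).
  have tn0 c : c ==> (t != 0%R) by rewrite (gt_eqF t0) implybT.
  rewrite (_ : a + b - 1 = 1 + ((a - 1) + (b - 1)))%R; last by ring.
  by rewrite (@powRD _ t 1)// (@powRD _ t (a - 1))// powRr1// ltW.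
- by apply: measurable_conv_fun; exact: measurable_power_kernel.
- by move=> x _; rewrite mule_ge0.
- by rewrite lee_fin mulr_ge0 ?powR_ge0.
Qed.

Lemma integral_causal (f : R -> \bar R) : measurable_fun setT f -> causal f ->
  \int[mu]_x f x = \int[mu]_(x in `]0%R, +oo[) f x.
Proof.
move=> mf cf; rewrite integral_itv_obnd_cbnd; last exact: measurable_funTS.
rewrite [RHS]integral_mkcond; apply: eq_integral => x _; rewrite patchE.
by case: ifPn => //; rewrite notin_setE/= in_itv/= andbT => /negP; rewrite -ltNge => /cf.
Qed.

(** The Gamma integral before taking [fine]: its functional equations follow from Tonelli, ahead of
    any proof of convergence. *)
Definition eGamma (a : R) : \bar R := \int[mu]_t (kp a t * (expR (- t))%:E).

Let measurable_eGamma_fun a : measurable_fun setT (fun t => kp a t * (expR (- t))%:E).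
Proof.
apply: emeasurable_funM; first exact: measurable_power_kernel.
apply/measurable_EFinP; apply: measurableT_comp => //.
Qed.

Let eGamma_fun_ge0 a t : 0 <= kp a t * (expR (- t))%:E.
Proof. by rewrite mule_ge0// lee_fin expR_ge0. Qed.

Lemma GammaE (a : R) : Gamma a = fine (eGamma a).
Proof.
rewrite /Gamma /Rintegral /eGamma integral_causal//; last first.
  by move=> t t0; rewrite power_kernel_causal// mul0e.
congr fine; apply: eq_integral => x; rewrite inE/= in_itv/= andbT => x0.
by rewrite power_kernel_pos ?ltW.
Qed.

(** Since [exp(-t)] is multiplicative, it factors out of the convolution of the two Gamma
    integrands; the integral of a convolution is the product of the integrals. *)
Lemma eGammaM a b :
  eGamma a * eGamma b = conv (kp a) (kp b) 1%R * eGamma (a + b).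
Proof.
rewrite /eGamma -integral_conv//.
have mab := measurable_conv (measurable_power_kernel a) (measurable_power_kernel b)
   (power_kernel_ge0 a) (power_kernel_ge0 b).
have -> : conv (fun t => kp a t * (expR (- t))%:E) (fun t => kp b t * (expR (- t))%:E) =
   fun t => conv (kp a) (kp b) t * (expR (- t))%:E.
  apply/funext => t; rewrite /conv -ge0_integralZr//.
  - apply: eq_integral => s _; rewrite muleACA; congr (_ * _).
    by rewrite -EFinM -expRD; congr (expR _)%:E; ring.
  - by apply: measurable_conv_fun; exact: measurable_power_kernel.
  - by move=> s _; rewrite mule_ge0.
rewrite integral_causal; last 2 first.
- apply: emeasurable_funM => //; apply/measurable_EFinP.
  exact: measurableT_comp.
- by move=> t t0; rewrite (conv_causal (@power_kernel_causal a) (@power_kernel_causal b))// mul0e.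
rewrite integral_causal//; last first.
  by move=> t t0; rewrite power_kernel_causal// mul0e.
have B0 : 0 <= conv (kp a) (kp b) 1%R by apply: conv_ge0.
transitivity (\int[mu]_(t in `]0%R, +oo[)
    (conv (kp a) (kp b) 1%R * (kp (a + b) t * (expR (- t))%:E))).
  apply: eq_integral => t; rewrite inE/= in_itv/= andbT => t0.
  by rewrite conv_power_kernel// power_kernel_pos ?ltW// muleA.
move: (conv _ _ _) B0 => B B0; apply: ge0_integralZl => //.
by apply: measurable_funTS; exact: measurable_eGamma_fun.
Qed.

Lemma conv_power_kernel_heaviside1 (a : R) : (0 < a)%R ->
  conv (kp a) heaviside 1%R = (a^-1)%:E.
Proof.
move=> a0; rewrite conv_heaviside// -integral_itv_obnd_cbnd; last first.
  by apply: measurable_funTS; exact: measurable_power_kernel.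
rewrite -integral_powR01//; apply: eq_integral => x.
by rewrite inE/= in_itv/= => /andP[x0 _]; rewrite power_kernel_pos ?ltW.
Qed.

Lemma conv_power_kernel_heaviside (a t : R) : (0 < a)%R ->
  conv (kp a) heaviside t = (a^-1)%:E * kp (a + 1) t.
Proof.
move=> a0; have [t0|t0|->] := ltgtP t 0%R.
- by rewrite power_kernel_causal// mule0 conv_causal.
- rewrite -power_kernel1 conv_power_kernel// power_kernel1.
  by rewrite conv_power_kernel_heaviside1// power_kernel_pos ?ltW.
- rewrite conv_heaviside// set_itv1 integral_set1 power_kernel_pos// addrK.
  by rewrite powR0 ?gt_eqF// mule0.
Qed.

Lemma eGamma1 : eGamma 1%R = 1.
Proof.
rewrite /eGamma power_kernel1 -(integral_exponential_pdf (@ltr01 R)).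
apply: eq_integral => x _; have [x0|x0] := ltP x 0%R.
  by rewrite heaviside_causal// mul0e lt0_exponential_pdf.
rewrite heaviside1// mul1e /exponential_pdf patchE ifT ?mul1r ?mulN1r//.
by rewrite inE/= in_itv/= x0.
Qed.

(** The Beta relation with second index 1, where B(a, 1) = 1/a; no integration by parts. *)
Lemma eGammaS a : (0 < a)%R -> eGamma a = (a^-1)%:E * eGamma (a + 1).
Proof.
move=> a0; rewrite -[LHS]mule1 -eGamma1 eGammaM power_kernel1.
by rewrite conv_power_kernel_heaviside1.
Qed.

Lemma eGamma_ge0 a : 0 <= eGamma a.
Proof. exact: integral_ge0. Qed.

(** On [[1, 2]] the power [t^(b-1)] is at most [1 + t], so the values at 1 and 2 bound the integral;
    the functional equation reaches []0, 1[]. *)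
Lemma eGamma_fin_num (a : R) : (0 < a)%R -> (a < 2)%R -> eGamma a \is a fin_num.
Proof.
have G2 : eGamma (1 + 1)%R = 1.
  have := eGammaS (@ltr01 R); rewrite eGamma1 invr1 mul1e.
  by move=> <-.
have H b : (1 <= b)%R -> (b <= 2)%R -> eGamma b \is a fin_num.
  move=> b1 b2; rewrite ge0_fin_numE ?eGamma_ge0//.
  apply: (@le_lt_trans _ _ (eGamma 1 + eGamma (1 + 1)%R)); last first.
    by rewrite eGamma1 G2 -EFinD ltry.
  rewrite /eGamma -ge0_integralD//; [|exact: measurable_eGamma_fun..].
  apply: ge0_le_integral => //.
  - exact: measurable_eGamma_fun.
  - by apply: emeasurable_funD; exact: measurable_eGamma_fun.
  - move=> t _; rewrite -ge0_muleDl//; apply: lee_wpmul2r.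
      by rewrite lee_fin expR_ge0.
    have [t0|t0] := ltP t 0%R; first by rewrite !power_kernel_causal// adde0.
    rewrite !power_kernel_pos// -EFinD lee_fin subrr powRr0 addrK powRr1//.
    have [t1|t1] := leP t 1%R.
      apply: (@le_trans _ _ 1%R); last by rewrite lerDl.
      apply: (@le_trans _ _ (1 `^ (b - 1))%R); last by rewrite powR1.
      by rewrite ge0_ler_powR// ?nnegrE ?subr_ge0.
    rewrite -[leLHS]add0r lerD// -[leRHS]powRr1//; apply: ler_powR; first exact: ltW.
    by rewrite lerBlDr.
move=> a0 a2; have [a1|a1] := leP 1%R a; first by rewrite H// ltW.
rewrite eGammaS// fin_numM// H//; first by rewrite -[leLHS]add0r lerD2r ltW.
by rewrite (_ : 2 = 1 + 1)%R// lerD2r ltW.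
Qed.

Lemma eGamma_gt0 (a : R) : (0 < a)%R -> 0 < eGamma a.
Proof.
move=> a0; apply: (@lt_le_trans _ _ ((expR (-1))%:E * conv (kp a) heaviside 1%R)).
  by rewrite conv_power_kernel_heaviside1// -EFinM lte_fin mulr_gt0 ?expR_gt0 ?invr_gt0.
have mh : measurable_fun setT (fun s : R => kp a s * heaviside (1 - s)%R).
  apply: measurable_conv_fun; first exact: measurable_power_kernel.
  exact: measurable_heaviside.
rewrite /conv -ge0_integralZl//; last by move=> s _; rewrite mule_ge0.
apply: ge0_le_integral => //.
- by move=> s _; apply: mule_ge0; [rewrite lee_fin expR_ge0|exact: mule_ge0].
- exact: measurable_funeM.
- exact: measurable_eGamma_fun.
- move=> s _; rewrite muleCA; apply: lee_wpmul2l => //.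
  have [s1|s1] := leP s 1%R.
    by rewrite heaviside1 ?subr_ge0// mule1 lee_fin ler_expR lerN2.
  by rewrite heaviside_causal ?subr_lt0// mule0 lee_fin expR_ge0.
Qed.

End power_kernel.
#[global] Hint Resolve power_kernel_ge0 power_kernel_causal : core.

(** * Asymptotic equivalence *)

Section asymptotic_equivalence.
Context {R : realType}.
Local Open Scope ereal_scope.
Implicit Types f g k : R -> \bar R.
Notation mu := (@lebesgue_measure R).

(* For extended-real functions [f ~ g] is stated multiplicatively, so that no
   division is involved and integrals can be compared without integrability. *)
Definition aeq f g := forall c : R, (1 < c)%R ->
  \forall t \near +oo%R, f t <= c%:E * g t /\ g t <= c%:E * f t.

Lemma aeq_sym f g : aeq f g -> aeq g f.
Proof. by move=> fg c c1; apply: filterS (fg c c1) => t []. Qed.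

Lemma aeq_trans g f k : aeq f g -> aeq g k -> aeq f k.
Proof.
move=> fg gk c c1; have c0 : (0 <= c)%R by apply/ltW/(lt_trans ltr01).
have b1 : (1 < Num.sqrt c)%R by rewrite -sqrtr1 ltr_sqrt ?(lt_trans ltr01).
have b0 : 0 <= (Num.sqrt c)%:E by rewrite lee_fin sqrtr_ge0.
have bb : c%:E = (Num.sqrt c)%:E * (Num.sqrt c)%:E.
  by rewrite -EFinM -expr2 sqr_sqrtr.
apply: filterS2 (fg _ b1) (gk _ b1) => t [fg1 fg2] [gk1 gk2].
rewrite bb -!muleA; split.
  by apply: le_trans fg1 _; apply: lee_wpmul2l.
by apply: le_trans gk2 _; apply: lee_wpmul2l.
Qed.

Lemma near_eq_aeq f g : (\forall t \near +oo%R, f t = g t) ->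
  (\forall t \near +oo%R, 0 <= g t) -> aeq f g.
Proof.
move=> fg g0 c c1; apply: filterS2 fg g0 => t -> g0.
suff : g t <= c%:E * g t by [].
by rewrite -[leLHS]mul1e; apply: lee_wpmul2r => //; rewrite lee_fin ltW.
Qed.

Lemma aeqZ (a : R) f g : (0 <= a)%R -> aeq f g ->
  aeq (fun t => a%:E * f t) (fun t => a%:E * g t).
Proof.
move=> a0 fg c c1; apply: filterS (fg c c1) => t [fgt gft].
by split; rewrite muleCA; apply: lee_wpmul2l.
Qed.

Lemma aeq_asymp_equiv f (g : R -> R) : (\forall t \near +oo%R, (0 < g t)%R) ->
  aeq f (fun t => (g t)%:E) -> asymp_equiv (fun t => fine (f t)) g.
Proof.
move=> g0 fg; apply/cvgrPdist_le => e e0.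
have e1 : (1 < 1 + e)%R by rewrite ltrDl.
apply: filterS2 g0 (fg _ e1) => t gt0; case: (f t) => [x||]; last 2 first.
- by rewrite -EFinM leye_eq => -[].
- by move=> [_]; rewrite gt0_muleNy ?lte_fin ?(lt_trans ltr01)// leeNy_eq.
rewrite -!EFinM !lee_fin /= => -[xg gx].
rewrite ler_norml; apply/andP; split.
  by rewrite lerBrDr addrC -lerBrDr opprK ler_pdivrMr.
rewrite lerBlDr -lerBlDl ler_pdivlMr//.
have x0 : (0 <= x)%R.
  by rewrite -(@pmulr_rge0 _ (1 + e)%R) ?(lt_trans ltr01)// (le_trans (ltW gt0)).
by nra.
Qed.

Lemma asymp_equiv_aeq (f g : R -> R) : (\forall t \near +oo%R, (0 < g t)%R) ->
  asymp_equiv f g -> aeq (fun t => (f t)%:E) (fun t => (g t)%:E).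
Proof.
move=> g0 /cvgrPdist_le fg c c1; have c0 := lt_trans ltr01 c1.
have e0 : (0 < 1 - c^-1)%R by rewrite subr_gt0 invf_lt1.
apply: filterS2 g0 (fg _ e0) => t gt0; rewrite ler_norml => /andP[h1 h2].
have h3 : (c^-1 <= f t / g t)%R by lra.
have h4 : (f t / g t <= 1 + (1 - c^-1))%R by lra.
have ci : (c * c^-1 = 1)%R by rewrite mulfV// gt_eqF.
have h5 : (1 + (1 - c^-1) <= c)%R.
  have ci0 : (0 < c^-1)%R by rewrite invr_gt0.
  by nra.
rewrite -!EFinM !lee_fin; split.
  by rewrite -ler_pdivrMr// (le_trans h4).
move: h3; rewrite ler_pdivlMr// => h3.
by rewrite -[leLHS]mul1r -ci -mulrA ler_pM2l.
Qed.

(** The initial piece of [f], on which an asymptotic equivalence gives no control. *)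
Definition trunc (A : R) f s := (\1_(`]-oo, A[%classic : set R) s)%:E * f s.

Lemma trunc_ge0 A f s : (forall x, 0 <= f x) -> 0 <= trunc A f s.
Proof. by move=> f0; rewrite mule_ge0// lee_fin. Qed.

Lemma measurable_trunc A f : measurable_fun setT f -> measurable_fun setT (trunc A f).
Proof.
move=> mf; apply: emeasurable_funM => //; apply/measurable_EFinP.
exact: measurable_indic.
Qed.

Lemma trunc_lt A f s : (s < A)%R -> trunc A f s = f s.
Proof. by move=> sA; rewrite /trunc indicE mem_set ?mul1e//= in_itv. Qed.

Lemma trunc_ge A f s : (A <= s)%R -> trunc A f s = 0.
Proof.
by move=> As; rewrite /trunc indicE memNset ?mul0e//= in_itv/= ltNge As.
Qed.

Lemma integral_trunc_le A f : (forall x, 0 <= f x) -> measurable_fun setT f ->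
  \int[mu]_s trunc A f s <= conv f heaviside A.
Proof.
move=> f0 mf; apply: ge0_le_integral => //.
- by move=> s _; exact: trunc_ge0.
- exact: measurable_trunc.
- by apply: measurable_conv_fun => //; exact: measurable_heaviside.
- move=> s _; have [sA|As] := ltP s A.
    by rewrite trunc_lt// heaviside1 ?mule1// subr_ge0 ltW.
  by rewrite trunc_ge// mule_ge0.
Qed.

Lemma conv_trunc_le (A t K : R) f k : (0 <= K)%R ->
  (forall x, 0 <= f x) -> measurable_fun setT f -> causal f ->
  (forall x, 0 <= k x) -> measurable_fun setT k ->
  (forall s, (0 <= s < A)%R -> k (t - s)%R <= K%:E) ->
  conv (trunc A f) k t <= K%:E * conv f heaviside A.
Proof.
move=> K0 f0 mf cf k0 mk kK.
apply: (@le_trans _ _ (K%:E * \int[mu]_s trunc A f s)); last first.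
  by apply: lee_wpmul2l; [rewrite lee_fin|exact: integral_trunc_le].
rewrite /conv -ge0_integralZl//; last 2 first.
- exact: measurable_trunc.
- by move=> s _; exact: trunc_ge0.
apply: ge0_le_integral => //.
- by move=> s _; rewrite mule_ge0// trunc_ge0.
- by apply: measurable_conv_fun => //; exact: measurable_trunc.
- by apply: measurable_funeM; exact: measurable_trunc.
- move=> s _; have [sA|As] := ltP s A; last by rewrite trunc_ge// mul0e mule0.
  have [s0|s0] := ltP s 0%R.
    by rewrite trunc_lt// cf// mul0e mule0.
  by rewrite muleC; apply: lee_wpmul2r; rewrite ?trunc_ge0// kK// s0.
Qed.

(** Beyond a fixed [A] the two functions are comparable pointwise, hence so are their convolutions
    with [k]; the pieces before [A] are negligible by hypothesis. Finiteness of [conv g k] allows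
    its small multiple to be absorbed. *)
Lemma conv_aeq f g k :
  (forall x, 0 <= f x) -> (forall x, 0 <= g x) -> (forall x, 0 <= k x) ->
  measurable_fun setT f -> measurable_fun setT g -> measurable_fun setT k ->
  aeq f g ->
  (\forall t \near +oo%R, conv g k t \is a fin_num) ->
  (forall A e, (0 < e)%R -> \forall t \near +oo%R,
    conv (trunc A f) k t <= e%:E * conv g k t) ->
  (forall A e, (0 < e)%R -> \forall t \near +oo%R,
    conv (trunc A g) k t <= e%:E * conv g k t) ->
  aeq (conv f k) (conv g k).
Proof.
move=> f0 g0 k0 mf mg mk fg gfin tf tg c c1.
have c0 := lt_trans ltr01 c1.
pose b := ((1 + c) / 2)%R.
have b1 : (1 < b)%R by rewrite /b; lra.
have b0 : (0 <= b)%R by rewrite ltW// (lt_trans ltr01).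
(* Chosen so that [e + b <= c], for the upper bound, and [c (1 - e) = b], which turns
   [y <= e y + b x] into [y <= c x]. *)
pose e := ((c - b) / c)%R.
have e0 : (0 < e)%R by rewrite divr_gt0// /b; lra.
have ec : (e * c = c - b)%R by rewrite /e divfK// gt_eqF.
have ecb : (e + b <= c)%R by nra.
have [A0 [_ A0P]] := fg b b1; pose A := (A0 + 1)%R.
have AP s : (A <= s)%R -> f s <= b%:E * g s /\ g s <= b%:E * f s.
  by move=> As; apply: A0P; rewrite (lt_le_trans _ As)// /A ltrDl.
have key u v t : (forall x, 0 <= u x) -> (forall x, 0 <= v x) ->
    measurable_fun setT u -> measurable_fun setT v ->
    (forall s, (A <= s)%R -> u s <= b%:E * v s) ->
    conv u k t <= conv (trunc A u) k t + b%:E * conv v k t.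
  move=> u0 v0 mu' mv uv; rewrite -convZl// -convDl//; last 4 first.
  - exact: measurable_trunc.
  - exact: measurable_funeM.
  - by move=> x; exact: trunc_ge0.
  - by move=> x; rewrite mule_ge0.
  apply: le_conv => //.
  - by apply: emeasurable_funD; [exact: measurable_trunc|exact: measurable_funeM].
  - by move=> x; rewrite adde_ge0 ?mule_ge0 ?trunc_ge0.
  - move=> s; apply: lee_wpmul2r => //; have [sA|As] := ltP s A.
      by rewrite trunc_lt// leeDl// mule_ge0.
    by rewrite trunc_ge// add0e uv.
apply: filterS3 gfin (tf A e e0) (tg A e e0) => t.
have := key f g t f0 g0 mf mg (fun s As => proj1 (AP s As)).
have := key g f t g0 f0 mg mf (fun s As => proj2 (AP s As)).
have := conv_ge0 t g0 k0; have := conv_ge0 t f0 k0.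
move: (conv f k t) (conv g k t) (conv (trunc A f) k t) (conv (trunc A g) k t).
move=> x y x1 y1 x0 + yxy xxy; case: y yxy xxy => [y||]// yxy xxy y0 _ tx ty.
split.
  apply: le_trans xxy _; apply: (@le_trans _ _ (e%:E * y%:E + b%:E * y%:E)).
    by rewrite leeD2r.
  by rewrite -!EFinM -EFinD lee_fin -mulrDl ler_wpM2r// -lee_fin.
have : y%:E <= e%:E * y%:E + b%:E * x by apply: le_trans yxy _; rewrite leeD2r.
case: x x0 {yxy xxy tx} => [x||]// x0.
  rewrite -!EFinM -EFinD !lee_fin; rewrite !lee_fin in x0 y0 => H.
  have : (y * (c * (1 - e)) <= c * (b * x))%R by nra.
  rewrite (_ : c * (1 - e) = b)%R; last by lra.
  have bp : (0 < b)%R by exact: lt_trans b1.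
  by rewrite mulrC (mulrCA c) ler_pM2l.
by move=> _; rewrite gt0_muley ?leey ?lte_fin.
Qed.

End asymptotic_equivalence.

(** * Monotone density *)

(* Convexity of [powR ^~ r], obtained from Young's inequality. *)
Lemma powR_tangent {R : realType} (r l : R) : (1 < r) -> (0 < l) ->
  (l `^ r - 1 <= r * l `^ (r - 1) * (l - 1)).
Proof.
move=> r1 l0; have r0 : (0 < r) by exact: lt_trans r1.
have r10 : (0 < r - 1) by rewrite subr_gt0.
have lE : (l `^ r = l * l `^ (r - 1)) by rewrite mulr_powRB1// ltW.
have := @conjugate_powR R 1 (l `^ (r - 1)) r (r / (r - 1)) ler01 (powR_ge0 _ _) r0
  (divr_gt0 r0 r10).
rewrite invf_div mul1r powR1 -powRrM [(r - 1) * (r / _)]mulrC divfK ?gt_eqF//.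
have -> : (r^-1 + (r - 1) / r = 1) by field; rewrite gt_eqF.
move=> /(_ erefl).
rewrite -(ler_pM2l r0) (_ : r * (1 / r + _) = 1 + (r - 1) * l `^ r); last first.
  by field; rewrite gt_eqF// gt_eqF.
by rewrite lE; set y := powR _ _; lra.
Qed.

Section monotone_density.
Context {R : realType}.
Local Open Scope ereal_scope.
Notation mu := (@lebesgue_measure R).

Lemma near_pinfty_comp (phi : R -> R) (Q : R -> Prop) :
  (forall K : R, \forall t \near +oo%R, (K < phi t)%R) ->
  (\forall t \near +oo%R, Q t) -> \forall t \near +oo%R, Q (phi t).
Proof. by move=> phioo [A [_ AQ]]; apply: filterS (phioo A) => t; exact: AQ. Qed.

Lemma near_pinfty_scale (a : R) (Q : R -> Prop) : (0 < a)%R ->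
  (\forall t \near +oo%R, Q t) -> \forall t \near +oo%R, Q (a * t)%R.
Proof.
move=> a0; apply: near_pinfty_comp => K.
apply: filterS (nbhs_pinfty_gt (num_real (K / a))) => t.
by rewrite ltr_pdivrMr// mulrC.
Qed.

Lemma near_pinfty_shift (a : R) (Q : R -> Prop) :
  (\forall t \near +oo%R, Q t) -> \forall t \near +oo%R, Q (t + a)%R.
Proof.
apply: near_pinfty_comp => K.
by apply: filterS (nbhs_pinfty_gt (num_real (K - a)%R)) => t; rewrite ltrBlDr.
Qed.

Context (M : R -> \bar R).
Hypotheses (M_ge0 : forall t, 0 <= M t) (M_causal : causal M)
  (mM : measurable_fun setT M) (M_nd : forall s t, (s <= t)%R -> M s <= M t)
  (M_fin : forall t, M t \is a fin_num).

Let N := conv M heaviside.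

Let N_fin t : N t \is a fin_num.
Proof.
rewrite ge0_fin_numE ?conv_ge0//; have [t0|t0] := ltP t 0%R.
  by rewrite /N conv_causal.
rewrite /N conv_heaviside//.
apply: (@le_lt_trans _ _ (\int[mu]_(s in `[0%R, t]) (cst (M t) s))).
  apply: ge0_le_integral => //.
  - exact: measurable_funTS.
  - by move=> s /=; rewrite in_itv/= => /andP[_ st]; exact: M_nd.
rewrite integral_cst//= lebesgue_measure_itv/= lte_fin.
have Mt := M_fin t; case: ifP => _; last by rewrite mule0.
by rewrite oppr0 adde0 -(fineK Mt) -EFinM ltry.
Qed.

Let N_incr s t : (0 <= s)%R -> (s <= t)%R ->
  (fine (M s) * (t - s) <= fine (N t) - fine (N s) <= fine (M t) * (t - s))%R.
Proof.
move=> s0; rewrite le_eqVlt => /predU1P[<-|st]; first by rewrite !subrr !mulr0 lexx.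
have NE : N t = N s + \int[mu]_(u in `]s, t]) M u.
  rewrite /N !conv_heaviside// -ge0_integral_setU//.
  - by rewrite -itv_bndbnd_setU// bnd_simp// ltW.
  - exact: measurable_funTS.
  - apply/disj_setPS => y [/=]; rewrite 2!in_itv/= => /andP[_ ys] /andP[+ _].
    by rewrite ltNge ys.
have cstE (x : R) : \int[mu]_(u in `]s, t]) (cst (M x) u) = (fine (M x) * (t - s))%:E.
  rewrite integral_cst//= lebesgue_measure_itv/= lte_fin st EFinM fineK//.
have mMst : measurable_fun `]s, t] M by exact: measurable_funTS.
have I1 : \int[mu]_(u in `]s, t]) (cst (M s) u) <= \int[mu]_(u in `]s, t]) M u.
  apply: ge0_le_integral => //.
    by move=> u _; exact: M_ge0.
  by move=> u /=; rewrite in_itv/= => /andP[su _]; apply: M_nd; exact: ltW.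
have I2 : \int[mu]_(u in `]s, t]) M u <= \int[mu]_(u in `]s, t]) (cst (M t) u).
  apply: ge0_le_integral => //.
  by move=> u /=; rewrite in_itv/= => /andP[_ ut]; exact: M_nd.
have : \int[mu]_(u in `]s, t]) M u = (fine (N t) - fine (N s))%:E.
  by rewrite EFinB (fineK (N_fin t)) (fineK (N_fin s)) NE [N s + _]addeC addeK ?N_fin.
by move=> IE; move: I1 I2; rewrite !cstE IE !lee_fin => -> ->.
Qed.

(** By monotonicity [M(t) (l - 1) t <= N(l t) - N(t)] for [l > 1], and the reverse inequality holds
    with [m = 1/l < 1]. For [l] near 1 the increments of [D t^r] are close to its derivative, by
    convexity of the power. *)
Lemma monotone_density (D r : R) : (0 < D)%R -> (1 < r)%R ->
  aeq (conv M heaviside) (fun t => (D * t `^ r)%:E) ->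
  aeq M (fun t => (D * r * t `^ (r - 1))%:E).
Proof.
move=> D0 r1 ND c c1; have c0 := lt_trans ltr01 c1.
have r0 : (0 < r)%R by exact: lt_trans r1.
have r10 : (0 < r - 1)%R by rewrite subr_gt0.
pose c' := Num.sqrt c.
have c'1 : (1 < c')%R by rewrite -sqrtr1 ltr_sqrt.
have c'0 := lt_trans ltr01 c'1.
have c'c : (c' * c' = c)%R by rewrite -expr2 sqr_sqrtr// ltW.
pose l := (c' `^ (r - 1)^-1)%R.
have lr : (l `^ (r - 1) = c')%R by rewrite -powRrM mulVf ?gt_eqF// powRr1// ltW.
have l1 : (1 < l)%R.
  rewrite ltNge; apply/negP => l1; have : (l `^ (r - 1) <= 1 `^ (r - 1))%R.
    by rewrite ge0_ler_powR// ?nnegrE ?powR_ge0// ltW.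
  by rewrite lr powR1 leNgt c'1.
have l0 := lt_trans ltr01 l1.
have powE t x : (0 < t)%R -> (0 < x)%R -> ((x * t) `^ r = x `^ r * (t * t `^ (r - 1)))%R.
  by move=> t0 x0; rewrite powRM ?ltW// mulr_powRB1// ltW.
(* [t] is compared with [l * t] (resp. [l^-1 * t]), where [l `^ (r - 1)] is [c']. *)
pose m := l^-1%R.
have m0 : (0 < m)%R by rewrite invr_gt0.
have m1 : (m < 1)%R by rewrite invf_lt1.
have mr : (m `^ (r - 1) = c'^-1)%R.
  by rewrite /m -powR_inv1 ?ltW// -powRrM mulN1r powRN lr.
have tl := powR_tangent r1 l0; have tm := powR_tangent r1 m0.
rewrite lr in tl; rewrite mr in tm.
(* The tangent inequality costs the factor [c']; what lies between [c'] and [c] is left for the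
   error in [N]. As [b l^r - (2 - b) = (l^r - 1) + (b - 1)(l^r + 1)], the error fits once
   [b - 1 <= d1]; likewise [d2] for [m]. *)
pose d1 := (r * (c - c') * (l - 1) / (l `^ r + 1))%R.
pose d2 := (r * (c'^-1 - c^-1) * (1 - m) / (m `^ r + 1))%R.
have lr1 : (0 < l `^ r + 1)%R by rewrite addr_gt0// powR_gt0.
have mr1 : (0 < m `^ r + 1)%R by rewrite addr_gt0// powR_gt0.
have d10 : (0 < d1)%R.
  by rewrite divr_gt0// !mulr_gt0// subr_gt0// -c'c ltr_pMr.
have d20 : (0 < d2)%R.
  by rewrite divr_gt0// !mulr_gt0// subr_gt0// ltf_pV2 ?posrE// -c'c ltr_pMr.
pose b := (1 + Num.min d1 d2)%R.
have b1 : (1 < b)%R by rewrite ltrDl lt_min d10.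
have b0 := lt_trans ltr01 b1.
have bd1 : ((b - 1) * (l `^ r + 1) <= r * (c - c') * (l - 1))%R.
  by rewrite -ler_pdivlMr// /b (addrC 1%R) addrK ge_min lexx.
have bd2 : ((b - 1) * (m `^ r + 1) <= r * (c'^-1 - c^-1) * (1 - m))%R.
  by rewrite -ler_pdivlMr// /b (addrC 1%R) addrK ge_min lexx orbT.
(* Makes the lower bound on [N] linear in [b]. *)
have bV : (2 - b <= b^-1)%R.
  by rewrite -(ler_pM2l b0) mulfV ?gt_eqF//; nra.
pose nN t := fine (N t).
have N1 : \forall t \near +oo%R,
    (nN t <= b * (D * t `^ r) /\ D * t `^ r <= b * nN t)%R.
  apply: filterS (ND b b1) => t; rewrite -/(N t) -(fineK (N_fin t)).
  by rewrite -!EFinM !lee_fin.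
have N2 := near_pinfty_scale l0 N1; have N3 := near_pinfty_scale m0 N1.
have tpos := nbhs_pinfty_gt (num_real (0 : R)).
apply: filterS2 tpos (filterI N1 (filterI N2 N3)) => t t0 [[h1 h2] [[h3 _] [h4 _]]].
have tt : (t <= l * t)%R by rewrite ler_peMl ?ltW.
have mt : (m * t <= t)%R by rewrite ler_piMl ?ltW.
have mt0 : (0 <= m * t)%R by rewrite mulr_ge0 ?ltW.
have /andP[I1 _] := N_incr (ltW t0) tt; have /andP[_ I2] := N_incr mt0 mt.
move: I1 I2; rewrite -(fineK (M_fin t)) -!EFinM !lee_fin -/(nN t) -/(nN (l * t)%R) -/(nN (m * t)%R).
have tE : (t `^ r = t * t `^ (r - 1))%R by rewrite mulr_powRB1// ltW.
have p0 : (0 < t `^ (r - 1))%R by rewrite powR_gt0.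
have y0 : (0 < t * t `^ (r - 1))%R by rewrite mulr_gt0.
move: h1 h2 h3 h4; rewrite !powE// tE.
move: (fine (M t)) (nN t) (nN (l * t)%R) (nN (m * t)%R) => x n nl nm.
move: (l `^ r)%R (m `^ r)%R (t `^ (r - 1))%R p0 y0 tl tm lr1 mr1 bd1 bd2.
move=> L Mu p p0 y0 tl tm lr1 mr1 bd1 bd2 h1 h2 h3 h4 I1 I2.
have h5 : (b^-1 * (D * (t * p)) <= n)%R by rewrite ler_pdivrMl.
have Dy : (0 < D * (t * p))%R by rewrite mulr_gt0.
have h6 : ((2 - b) * (D * (t * p)) <= n)%R.
  by apply: le_trans h5; rewrite ler_pM2r.
split.
  suff : (x * ((l - 1) * t) <= (c * (D * r * p)) * ((l - 1) * t))%R.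
    by rewrite ler_pM2r// mulr_gt0// subr_gt0.
  have G1 : (b * L - (2 - b) <= r * c * (l - 1))%R.
    rewrite -subr_ge0 (_ : _ - _ = (r * (c - c') * (l - 1) - (b - 1) * (L + 1)) +
      (r * c' * (l - 1) - (L - 1)))%R; last by ring.
    by rewrite addr_ge0 ?subr_ge0.
  rewrite (_ : x * _ = x * (l * t - t))%R; last by ring.
  apply: le_trans I1 (le_trans (lerB h3 h6) _).
  rewrite (_ : _ - _ = (b * L - (2 - b)) * (D * (t * p)))%R; last by ring.
  rewrite (_ : c * _ * _ = r * c * (l - 1) * (D * (t * p)))%R; last by ring.
  by rewrite ler_pM2r.
suff : (c^-1 * (D * r * p) * ((1 - m) * t) <= x * ((1 - m) * t))%R.
  by rewrite ler_pM2r ?mulr_gt0// ?subr_gt0// ler_pdivrMl.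
have G1 : (r * c^-1 * (1 - m) <= (2 - b) - b * Mu)%R.
  rewrite -subr_ge0 (_ : _ - _ = (r * (c'^-1 - c^-1) * (1 - m) - (b - 1) * (Mu + 1)) +
    (r * c'^-1 * (m - 1) - (Mu - 1)))%R; last by ring.
  by rewrite addr_ge0 ?subr_ge0.
rewrite [leRHS](_ : _ = x * (t - m * t))%R; last by ring.
apply: le_trans I2; apply: le_trans (lerB h6 h4).
rewrite [leRHS](_ : _ = ((2 - b) - b * Mu) * (D * (t * p)))%R; last by ring.
rewrite [leLHS](_ : _ = r * c^-1 * (1 - m) * (D * (t * p)))%R; last by ring.
by rewrite ler_pM2r.
Qed.

End monotone_density.

(** * The critical renewal equation *)

Section critical_renewal.
Context {R : realType}.
Notation mu := (@lebesgue_measure R).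
Local Open Scope ereal_scope.
Variables (k : R) (p M : R -> \bar R).
Hypotheses (k0 : (0 < k)%R)
  (p_ge0 : forall t, 0 <= p t) (p_causal : causal p) (mp : measurable_fun setT p)
  (M_ge0 : forall t, 0 <= M t) (M_causal : causal M) (mM : measurable_fun setT M)
  (M_nd : forall s t, (s <= t)%R -> M s <= M t)
  (M_fin : forall t, M t \is a fin_num)
  (M_renewal : forall t, M t = heaviside t + k%:E * conv p M t)
  (p_int : k%:E * \int[mu]_t p t = 1).

Let mh := @measurable_heaviside R.
Let k0' : (0 <= k)%R. Proof. exact: ltW. Qed.

(** The function [F] of the overview: the survival function of the probability density [k p]. *)
Definition tail (t : R) : \bar R :=
  heaviside t * (k%:E * \int[mu]_(s in `]t, +oo[) p s).

Lemma tail_ge0 t : 0 <= tail t.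
Proof. by rewrite mule_ge0// mule_ge0// integral_ge0. Qed.

Lemma tail_causal : causal tail.
Proof. by move=> t t0; rewrite /tail heaviside_causal// mul0e. Qed.

Lemma tail_split t : heaviside t = tail t + k%:E * conv p heaviside t.
Proof.
have [t0|t0] := ltP t 0%R.
  by rewrite tail_causal// conv_causal// mule0 adde0 heaviside_causal.
rewrite /tail heaviside1// mul1e conv_heaviside// -ge0_muleDr; last 2 first.
- by rewrite integral_ge0.
- by rewrite integral_ge0.
rewrite addeC -ge0_integral_setU//; last 2 first.
- exact: measurable_funTS.
- apply/disj_setPS => y [/=]; rewrite 2!in_itv/= => /andP[_ yt] /andP[+ _].
  by rewrite ltNge yt.
rewrite -itv_bndbnd_setU ?bnd_simp// -integral_itv_obnd_cbnd; last exact: measurable_funTS.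
by rewrite -integral_causal.
Qed.

Let ph_ge0 t : 0 <= conv p heaviside t. Proof. exact: conv_ge0. Qed.

Let kph_fin t : k%:E * conv p heaviside t \is a fin_num.
Proof.
rewrite ge0_fin_numE ?mule_ge0//.
apply: (@le_lt_trans _ _ (heaviside t)); last by rewrite /heaviside ltry.
by rewrite tail_split leeDr// tail_ge0.
Qed.

Lemma tail_le1 t : tail t <= heaviside t.
Proof. by rewrite tail_split leeDl// mule_ge0. Qed.

Lemma measurable_tail : measurable_fun setT tail.
Proof.
rewrite (_ : tail = fun t => heaviside t - k%:E * conv p heaviside t).
  apply: emeasurable_funB; first exact: mh.
  by apply: measurable_funeM; apply: measurable_conv.
by apply/funext => t; rewrite tail_split addeK.
Qed.

Let mtail := measurable_tail.

Let hh (t : R) : conv heaviside heaviside t = power_kernel 2%R t.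
Proof.
rewrite -{1}power_kernel1 conv_power_kernel_heaviside// invr1 mul1e.
by congr (power_kernel _ t).
Qed.

Lemma power_kernel2 (t : R) : (0 <= t)%R -> power_kernel 2%R t = t%:E.
Proof.
move=> t0; rewrite power_kernel_pos// (_ : 2 - 1 = 1)%R; last by ring.
by rewrite powRr1.
Qed.

Lemma conv_le_causal (f : R -> \bar R) t (x : R) : (0 <= x)%R ->
  (forall s, 0 <= f s) -> measurable_fun setT f -> causal f ->
  M t <= x%:E -> conv f M t <= x%:E * conv f heaviside t.
Proof.
move=> x0 f0 mf cf Mx; rewrite /conv -ge0_integralZl//; last 2 first.
- exact: measurable_conv_fun.
- by move=> s _; rewrite mule_ge0.
apply: ge0_le_integral => //.
- by move=> s _; rewrite mule_ge0.
- exact: measurable_conv_fun.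
- by apply: measurable_funeM; exact: measurable_conv_fun.
move=> s _; rewrite muleCA; have [s0|s0] := ltP s 0%R.
  by rewrite cf// !mul0e.
apply: lee_wpmul2l => //.
have [st|ts] := leP s t; last by rewrite M_causal ?subr_lt0// mule_ge0// lee_fin.
rewrite heaviside1 ?subr_ge0// mule1; apply: le_trans Mx; apply: M_nd.
by rewrite gerBl.
Qed.

Lemma conv_M_fin (f : R -> \bar R) t : (forall s, 0 <= f s) ->
  measurable_fun setT f -> causal f ->
  conv f heaviside t \is a fin_num -> conv f M t \is a fin_num.
Proof.
move=> f0 mf cf ffin; rewrite ge0_fin_numE ?conv_ge0//.
apply: (@le_lt_trans _ _ ((fine (M t))%:E * conv f heaviside t)).
  by apply: conv_le_causal; rewrite ?fine_ge0 ?fineK.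
by rewrite -(fineK ffin) -EFinM ltry.
Qed.

Let hh_fin t : conv (@heaviside R) heaviside t \is a fin_num.
Proof. by rewrite hh /power_kernel /heaviside -EFinM. Qed.

(** [M * 1] is expanded twice, through the renewal equation for [M] and through [1 = F + k p * 1].
    Both contain [k p * M * 1], which is finite and can be removed. *)
Lemma conv_M_tail t : conv M tail t = power_kernel 2%R t.
Proof.
have mph := measurable_conv mp mh p_ge0 (@heaviside_ge0 R).
have mMh := measurable_conv mM mh M_ge0 (@heaviside_ge0 R).
have mpM := measurable_conv mp mM p_ge0 M_ge0.
have pM0 x : 0 <= conv p M x by exact: conv_ge0.
have E1 : conv M heaviside t = conv heaviside heaviside t + k%:E * conv (conv p M) heaviside t.
  rewrite -convZl// -convDl//; last by move=> x; rewrite mule_ge0.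
    by congr (conv _ _ t); apply/funext => x; exact: M_renewal.
  exact: measurable_funeM.
have E2 : conv M heaviside t = conv M tail t + k%:E * conv (conv p M) heaviside t.
  have h0 := @heaviside_ge0 R.
  rewrite (convC mM mh M_ge0 h0) (convC mM mtail M_ge0 tail_ge0).
  rewrite (convC mp mM p_ge0 M_ge0) -(convA mM mp mh M_ge0 p_ge0 h0).
  rewrite (convC mM mph M_ge0 ph_ge0) -convZl// -convDl//.
  - by congr (conv _ _ t); apply/funext => x; exact: tail_split.
  - exact: measurable_funeM.
  - exact: tail_ge0.
  - by move=> x; rewrite mule_ge0.
have fin : k%:E * conv (conv p M) heaviside t \is a fin_num.
  have : conv M heaviside t \is a fin_num.
    by rewrite (convC mM mh)// conv_M_fin.
  by rewrite E1 fin_numD => /andP[].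
by rewrite -hh -(addeK (conv M tail t) fin) -E2 E1 addeK.
Qed.

Let m := conv tail heaviside.

Let tailM t : conv tail M t = power_kernel 2%R t.
Proof. by rewrite (convC mtail mM)//; [exact: conv_M_tail|exact: tail_ge0]. Qed.

Lemma sandwich_lower t : power_kernel 2%R t <= M t * m t.
Proof.
rewrite -tailM -(fineK (M_fin t)); apply: conv_le_causal => //.
- by rewrite fine_ge0.
- exact: tail_ge0.
- exact: tail_causal.
- by rewrite fineK.
Qed.

(** In [(F * M)(t + s)] only the part [u <= s] is kept, where [M(t + s - u) >= M(t)]. *)
Lemma sandwich_upper s t : (0 <= s)%R -> M t * m s <= power_kernel 2%R (t + s).
Proof.
move=> s0; rewrite -tailM -(fineK (M_fin t)) /m /conv -ge0_integralZl//; last 3 first.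
- exact: measurable_conv_fun.
- by move=> u _; rewrite mule_ge0// tail_ge0.
- by rewrite lee_fin fine_ge0.
apply: ge0_le_integral => //.
- by move=> u _; rewrite mule_ge0 ?lee_fin ?fine_ge0// mule_ge0// tail_ge0.
- by apply: measurable_funeM; exact: measurable_conv_fun.
- exact: measurable_conv_fun.
move=> u _; rewrite muleCA fineK//; apply: lee_wpmul2l; first exact: tail_ge0.
have [us|su] := leP u s; last by rewrite heaviside_causal ?subr_lt0// mule0.
rewrite heaviside1 ?subr_ge0// mule1; apply: M_nd.
by rewrite -addrA lerDl subr_ge0.
Qed.

Lemma m_fin t : m t \is a fin_num.
Proof.
rewrite ge0_fin_numE ?conv_ge0//; last exact: tail_ge0.
apply: (@le_lt_trans _ _ (conv heaviside heaviside t)).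
  apply: le_conv => //; [exact: tail_ge0|].
  by move=> s; apply: lee_wpmul2r; [exact: heaviside_ge0|exact: tail_le1].
by rewrite -ge0_fin_numE// conv_ge0.
Qed.

Lemma slowly_varying_case (l : R -> R) :
  (\forall t \near +oo%R, (0 < l t)%R) ->
  aeq m (fun t => (l t)%:E) ->
  (forall e, (0 < e)%R -> aeq (fun t => (l (e * t)%R)%:E) (fun t => (l t)%:E)) ->
  aeq M (fun t => (t / l t)%:E).
Proof.
move=> l0 ml le c c1; have c0 := lt_trans ltr01 c1.
(* [b] is the fourth root of [c]. With [s = (b - 1) t] the upper bound loses three factors [b]: slow
   variation of [l], replacing [l] by [m], and the time [t + s = b t]. *)
pose d := Num.sqrt c; pose b := Num.sqrt d.
have d1 : (1 < d)%R by rewrite -sqrtr1 ltr_sqrt.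
have d0 := lt_trans ltr01 d1.
have b1 : (1 < b)%R by rewrite -sqrtr1 ltr_sqrt.
have b0 := lt_trans ltr01 b1.
have bc : (b ^+ 4 = c)%R by rewrite (exprM b 2 2) !sqr_sqrtr// ltW.
have bc1 : (b <= c)%R by rewrite -bc -[leLHS]expr1; apply: ler_weXn2l => //; exact: ltW.
have e0 : (0 < b - 1)%R by rewrite subr_gt0.
have tpos := nbhs_pinfty_gt (num_real (0 : R)).
have Hl := near_pinfty_scale e0 (ml b b1).
apply: filterS2 (filterI tpos l0) (filterI (ml b b1) (filterI Hl (le _ e0 b b1))).
move=> t [t0 lt0] [[h1 _] [[_ h2] [_ h3]]].
have := sandwich_lower t; have := @sandwich_upper ((b - 1) * t)%R t.
rewrite (_ : t + (b - 1) * t = b * t)%R; last by ring.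
rewrite (power_kernel2 (ltW t0)) (power_kernel2 (ltW (mulr_gt0 b0 t0))).
move=> /(_ (ltW (mulr_gt0 e0 t0))).
move: h1 h2 h3; rewrite -(fineK (M_fin t)) -(fineK (m_fin t)) -(fineK (m_fin ((b - 1) * t)%R)).
rewrite -!EFinM !lee_fin.
have : (0 <= fine (M t))%R by rewrite fine_ge0.
move: (fine (M t)) (fine (m t)) (fine (m ((b - 1) * t)%R)) (l t) lt0
  (l ((b - 1) * t)%R) => x y z lt lt0 let' x0 h1 h2 h3 h4 h5.
split.
  rewrite mulrA ler_pdivlMr// -bc.
  have H : (x * lt <= x * (b * (b * z)))%R.
    by rewrite ler_wpM2l// (le_trans h3)// ler_wpM2l// ltW.
  apply: le_trans H _; rewrite (_ : x * _ = b * b * (x * z))%R; last by ring.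
  apply: (@le_trans _ _ (b * b * (b * t)))%R; first by rewrite ler_wpM2l// mulr_ge0// ltW.
  rewrite (_ : b * b * _ = b ^+ 3 * t)%R; last by ring.
  by rewrite ler_wpM2r ?ltW// ltr_eXn2l.
rewrite ler_pdivrMr//; apply: le_trans h5 _.
apply: (@le_trans _ _ (x * (b * lt)))%R; first by rewrite ler_wpM2l.
rewrite (_ : x * _ = b * (x * lt))%R; last by ring.
by rewrite -mulrA ler_wpM2r// mulr_ge0// ltW.
Qed.

(** * Return probabilities with a power tail: the range alpha >= 2 *)

Variables (alpha c : R).
Hypotheses (c0 : (0 < c)%R) (alpha1 : (1 < alpha)%R)
  (p_aeq : aeq p (fun t => (c * t `^ (- alpha))%:E)).

(** The coefficient of [F] at infinity: [k] times the integral of [c s^(-alpha)] over [s > t] is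
    [C t^(1 - alpha)]. *)
Let C : R := (k * c / (alpha - 1))%R.

Let C0 : (0 < C)%R.
Proof. by rewrite divr_gt0 ?mulr_gt0 ?subr_gt0. Qed.

Lemma integralZl_powR (D : set R) (x r : R) : (0 <= x)%R -> measurable D ->
  \int[mu]_(s in D) (x * s `^ r)%:E = x%:E * \int[mu]_(s in D) (s `^ r)%:E.
Proof.
move=> x0 mD; rewrite -ge0_integralZl//.
- by apply/measurable_EFinP; apply: measurable_funTS; exact: measurable_powR.
- by move=> s _; rewrite lee_fin powR_ge0.
Qed.

Lemma tail_aeq : aeq tail (fun t => (C * t `^ (1 - alpha))%:E).
Proof.
move=> b b1; have [A [_ AP]] := p_aeq b1.
have b0 : (0 <= b)%R by rewrite ltW// (lt_trans ltr01).
have mpow : measurable_fun [set: R] (fun s => c * s `^ (- alpha))%R.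
  by apply: measurable_funM => //; exact: measurable_powR.
have pow0 s : (0 <= c * s `^ (- alpha))%R by rewrite mulr_ge0 ?powR_ge0// ltW.
apply: filterS2 (nbhs_pinfty_gt (num_real A)) (nbhs_pinfty_gt (num_real (0%R : R))).
move=> t At t0.
have JE : (C * t `^ (1 - alpha))%:E =
    k%:E * \int[mu]_(s in `]t, +oo[) (c * s `^ (- alpha))%:E.
  rewrite (integralZl_powR _ (ltW c0) (measurable_itv _)).
  rewrite integral_powR_tail//; last by rewrite ltrN2.
  rewrite -!EFinM (_ : - alpha + 1 = 1 - alpha)%R; last by ring.
  by congr EFin; rewrite opprB /C; field; rewrite subr_eq0 gt_eqF.
have bI u v : (forall s, (t < s)%R -> u s <= b%:E * v s) ->
    (forall s, 0 <= u s) -> (forall s, 0 <= v s) ->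
    measurable_fun [set: R] u -> measurable_fun [set: R] v ->
    k%:E * \int[mu]_(s in `]t, +oo[) u s <=
    b%:E * (k%:E * \int[mu]_(s in `]t, +oo[) v s).
  move=> uv u0 v0 mU mv; rewrite muleCA; apply: lee_wpmul2l => //.
  rewrite -ge0_integralZl//; last exact: measurable_funTS.
  apply: ge0_le_integral => //.
  - exact: measurable_funTS.
  - by apply: measurable_funTS; exact: measurable_funeM.
  - by move=> s /=; rewrite in_itv/= andbT; exact: uv.
rewrite JE /tail (heaviside1 (ltW t0)) mul1e; split; apply: bI => //.
- by move=> s ts; have [] := AP s (lt_trans At ts).
- exact/measurable_EFinP.
- by move=> s ts; have [] := AP s (lt_trans At ts).
- exact/measurable_EFinP.
Qed.

Lemma near_cst_le_ln (a V : R) : (0 < a)%R -> \forall t \near +oo%R, (V <= a * ln t)%R.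
Proof.
move=> a0; apply: filterS (nbhs_pinfty_gt (num_real (expR (V / a)))) => t Vt.
have t0 : (0 < t)%R by rewrite (lt_trans (expR_gt0 _) Vt).
rewrite mulrC -ler_pdivrMr// -ler_expR lnK ?posrE//; exact: ltW.
Qed.

Lemma trunc_heaviside_ln (f : R -> \bar R) (a A e : R) : (0 < a)%R -> (0 < e)%R ->
  (forall s, 0 <= f s) -> measurable_fun setT f -> causal f ->
  conv f heaviside A \is a fin_num ->
  \forall t \near +oo%R, conv (trunc A f) heaviside t <= e%:E * (a * ln t)%:E.
Proof.
move=> a0 e0 f0 mf cf fA.
apply: filterS (near_cst_le_ln (fine (conv f heaviside A)) (mulr_gt0 e0 a0)) => t Vt.
apply: (@le_trans _ _ (1%:E * conv f heaviside A)).
  apply: conv_trunc_le => // s _; rewrite /heaviside lee_fin indicE.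
  by case: (_ \in _).
by rewrite mul1e -(fineK fA) -EFinM lee_fin mulrA.
Qed.

Lemma m_aeq_ln : alpha = 2%R -> aeq m (fun t => (k * c * ln t)%:E).
Proof.
move=> a2; have CE : C = (k * c)%R by rewrite /C a2 (_ : 2 - 1 = 1)%R ?divr1//; ring.
(* [1/s] is not integrable at 0, so the model for [F] starts at 1; its integral is then exactly
   [C ln t] for [t >= 1]. *)
pose D : set R := `[1%R, +oo[%classic.
pose g (s : R) : \bar R := (\1_D s)%:E * (C * s `^ (- 1))%:E.
have g0 s : 0 <= g s by rewrite mule_ge0// lee_fin mulr_ge0 ?powR_ge0// ltW.
have mg : measurable_fun setT g.
  apply: emeasurable_funM; apply/measurable_EFinP.
    by apply: measurable_indic; exact: measurable_itv.
  by apply: measurable_funM => //; exact: measurable_powR.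
have gE s : (1 <= s)%R -> g s = (C * s `^ (- 1))%:E.
  by move=> s1; rewrite /g indicE mem_set ?mul1e//= /D/= in_itv/= s1.
have g_lt1 s : (s < 1)%R -> g s = 0.
  by move=> s1; rewrite /g indicE memNset ?mul0e//= /D/= in_itv/= andbT leNgt s1.
have cg : causal g by move=> s s0; apply: g_lt1; exact: lt_trans s0 _.
have gh1 t : (1 <= t)%R -> conv g heaviside t = (C * ln t)%:E.
  move=> t1; rewrite conv_heaviside// integral_indicM.
  transitivity (\int[mu]_(s in `[1%R, t]) (C * s^-1)%:E).
    rewrite [RHS]integral_indicM; apply: eq_integral => s _; rewrite !indicE.
    have [s1|s1] := ltP s 1%R.
      rewrite g_lt1// mule0 memNset ?mul0e//= in_itv/=.
      by rewrite leNgt s1.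
    rewrite gE// powR_inv1 ?(le_trans ler01)//; congr ((nat_of_bool _)%:R%:E * _).
    by apply/idP/idP; rewrite !inE/= !in_itv/= s1 (le_trans ler01 s1).
  transitivity (C%:E * \int[mu]_(s in `[1%R, t]) (s^-1)%:E).
    have -> : \int[mu]_(s in `[1%R, t]) (s^-1)%:E = \int[mu]_(s in `[1%R, t]) (s `^ (-1))%:E.
      apply: eq_integral => s; rewrite inE/= in_itv/= => /andP[s1 _].
      by rewrite powR_inv1// (le_trans ler01).
    rewrite -(integralZl_powR _ (ltW C0) (measurable_itv _)).
    apply: eq_integral => s; rewrite inE/= in_itv/= => /andP[s1 _].
    by rewrite powR_inv1// (le_trans ler01).
  by rewrite integral_inv_itv// ln1 subr0 -EFinM.
have gh_fin t : conv g heaviside t \is a fin_num.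
  have [t1|t1] := ltP t 1%R; last by rewrite gh1.
  have -> : conv g heaviside t = 0.
    rewrite conv_heaviside//; apply: integral0_eq => s /=; rewrite in_itv/=.
    by move=> /andP[_ st]; rewrite g_lt1// (le_lt_trans st).
  by [].
have near1 := nbhs_pinfty_ge (num_real (1%R : R)).
apply: (@aeq_trans _ (conv g heaviside)); last first.
  apply: near_eq_aeq.
    by apply: filterS near1 => t /gh1 ->; rewrite CE.
  apply: filterS near1 => t t1; rewrite lee_fin mulr_ge0 ?ln_ge0// mulr_ge0// ltW//.
apply: conv_aeq => //.
- exact: tail_ge0.
- apply: aeq_trans tail_aeq _; apply: aeq_sym; apply: near_eq_aeq.
    by apply: filterS near1 => t t1; rewrite gE// a2; congr (C * _ `^ _)%:E; ring.
  by apply: nearW => t; rewrite lee_fin mulr_ge0 ?powR_ge0// ltW.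
- exact: nearW.
- move=> A e e0; apply: filterS2 near1
    (trunc_heaviside_ln C0 e0 tail_ge0 mtail tail_causal (m_fin A)) => t t1.
  by rewrite gh1.
- move=> A e e0; apply: filterS2 near1
    (trunc_heaviside_ln C0 e0 g0 mg cg (gh_fin A)) => t t1.
  by rewrite gh1.
Qed.

Lemma moment_aeq2 : alpha = 2%R -> aeq M (fun t => (t / (k * c * ln t))%:E).
Proof.
move=> a2; have kc0 : (0 < k * c)%R by rewrite mulr_gt0.
have lnpos : \forall t \near +oo%R, (0 < ln (t : R))%R.
  by apply: filterS (nbhs_pinfty_gt (num_real (1%R : R))) => t; exact: ln_gt0.
apply: slowly_varying_case; last first.
- move=> e e0 b b1.
  have b10 : (0 < b - 1)%R by rewrite subr_gt0.
  have near0 := nbhs_pinfty_gt (num_real (0%R : R)).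
  have b0 : (0 < b)%R by exact: lt_trans b1.
  apply: filterS3 near0 (near_cst_le_ln (ln e) b10)
    (near_cst_le_ln (- (b * ln e)) b10) => t t0 h1 h2.
  rewrite lnM ?posrE// -!EFinM !lee_fin; split.
    by rewrite mulrCA ler_pM2l//; lra.
  by rewrite mulrCA ler_pM2l//; lra.
- exact: m_aeq_ln.
- by apply: filterS lnpos => t lt0; rewrite mulr_gt0.
Qed.

(** The mean of the density [k p] as the integral of its survival function: Tonelli leaves
    [(1 * 1)(s) = s] as the weight of [p s]. *)
Lemma integral_tail_power : \int[mu]_t tail t =
  k%:E * \int[mu]_t (p t * power_kernel 2 t).
Proof.
have pI t : \int[mu]_(s in `]t, +oo[) p s = \int[mu]_s (p s * heaviside (s - t)%R).
  rewrite integral_itv_obnd_cbnd; last exact: measurable_funTS.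
  rewrite integral_mkcond; apply: eq_integral => s _; rewrite patchE.
  case: ifPn => [|].
    by rewrite inE/= in_itv/= andbT => ts; rewrite heaviside1 ?mule1// subr_ge0.
  rewrite notin_setE/= in_itv/= andbT => /negP; rewrite -ltNge => st.
  by rewrite heaviside_causal ?mule0// subr_lt0.
pose F (z : R * R) : \bar R := heaviside z.1 * (p z.2 * heaviside (z.2 - z.1)%R).
have mF : measurable_fun setT F.
  apply: emeasurable_funM; first exact: measurableT_comp.
  apply: emeasurable_funM; first exact: measurableT_comp.
  by apply: measurableT_comp => //; exact: measurable_funB.
have F0 z : 0 <= F z by rewrite !mule_ge0.
have mpt t : measurable_fun [set: R] (fun s => p s * heaviside (s - t)%R).
  apply: emeasurable_funM => //; apply: measurableT_comp => //.
  exact: measurable_funB.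
transitivity (\int[mu]_t (k%:E * \int[mu]_s F (t, s))).
  apply: eq_integral => t _; rewrite /tail pI muleCA; congr (_ * _).
  rewrite -ge0_integralZl//; first exact: mpt.
  by move=> s _; rewrite mule_ge0.
rewrite ge0_integralZl//; last 2 first.
- exact: measurable_fun_fubini_tonelli_F.
- by move=> t _; exact: integral_ge0.
congr (_ * _); rewrite (fubini_tonelli (m1 := mu) (m2 := mu) F mF F0).
apply: eq_integral => s _; rewrite -hh /conv -ge0_integralZl//.
- by apply: eq_integral => t _; rewrite /F/= muleCA.
- exact: measurable_conv_fun.
- by move=> t _; rewrite mule_ge0.
Qed.

(** Here [F] is integrable and [m] tends to [k H], so the slowly varying comparison function is a
    constant. *)
Lemma moment_aeq_gt2 : (2 < alpha)%R ->
  let H := \int[mu]_t (p t * power_kernel 2 t) in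
  [/\ H \is a fin_num, (0 < fine H)%R & aeq M (fun t => (t / (k * fine H))%:E)].
Proof.
move=> a2 H.
have HE : k%:E * H = \int[mu]_t tail t by rewrite integral_tail_power.
have a20 : (0 < alpha - 2)%R by rewrite subr_gt0.
(* Far out [F(s) <= 2 C s^(1 - alpha)], whose integral beyond [t] is [K t^(2 - alpha)]. *)
pose K : R := (2 * C / (alpha - 2))%R.
have K0 : (0 < K)%R by rewrite divr_gt0// mulr_gt0.
have split_tail : \forall t \near +oo%R,
    \int[mu]_s tail s <= m t + (K * t `^ (- (alpha - 2)))%:E.
  have [A [_ AP]] := tail_aeq (ltr1n R 2).
  apply: filterS2 (nbhs_pinfty_gt (num_real A)) (nbhs_pinfty_gt (num_real (0%R : R))).
  move=> t At t0.
  rewrite integral_causal//; last exact: tail_causal.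
  rewrite integral_itv_obnd_cbnd; last exact: measurable_funTS.
  rewrite (@itv_bndbnd_setU _ _ _ (BRight t)) ?bnd_simp//; last exact: ltW.
  rewrite ge0_integral_setU//; last 3 first.
  - exact: measurable_funTS.
  - by move=> s _; exact: tail_ge0.
  - apply/disj_setPS => y [/=]; rewrite 2!in_itv/= => /andP[_ yt] /andP[+ _].
    by rewrite ltNge yt.
  rewrite /m conv_heaviside; last exact: tail_causal.
  rewrite leeD2l//.
  have mpow : measurable_fun [set: R] (fun s : R => (2 * C * s `^ (1 - alpha))%:E).
    by apply/measurable_EFinP; apply: measurable_funM => //; exact: measurable_powR.
  apply: (@le_trans _ _ (\int[mu]_(s in `]t, +oo[) ((2 * C) * s `^ (1 - alpha))%:E)).
    apply: ge0_le_integral => //.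
    - by move=> s _; exact: tail_ge0.
    - exact: measurable_funTS.
    - exact: measurable_funTS.
    - move=> s /=; rewrite in_itv/= andbT => ts.
      by have [+ _] := AP s (lt_trans At ts); rewrite -EFinM mulrA.
  have C20 : (0 <= 2 * C)%R by rewrite mulr_ge0// ltW.
  rewrite (integralZl_powR _ C20 (measurable_itv _)).
  rewrite integral_powR_tail//; last by lra.
  rewrite -EFinM lee_fin (_ : 1 - alpha + 1 = - (alpha - 2))%R; last by ring.
  by rewrite opprK /K mulrA mulrAC.
have near0 := nbhs_pinfty_gt (num_real (0%R : R)).
have I0 : 0 <= \int[mu]_s tail s by apply: integral_ge0 => s _; exact: tail_ge0.
have Ifin : \int[mu]_s tail s \is a fin_num.
  have [A [_ AP]] := split_tail.
  rewrite ge0_fin_numE//; apply: le_lt_trans (AP (A + 1)%R _) _; first by rewrite ltrDl.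
  by rewrite -(fineK (m_fin _)) -EFinD ltry.
have Hfin : H \is a fin_num.
  have H0 : 0 <= H by apply: integral_ge0 => s _; rewrite mule_ge0.
  have fin_numZ (x : \bar R) : 0 <= x -> k%:E * x \is a fin_num -> x \is a fin_num.
    by case: x => // _; rewrite gt0_muley ?lte_fin.
  by apply: fin_numZ H0 _; rewrite HE.
have mI t : m t <= \int[mu]_s tail s.
  rewrite /m conv_heaviside; last exact: tail_causal.
  apply: ge0_subset_integral => //.
  by move=> s _; exact: tail_ge0.
pose I := fine (\int[mu]_s tail s).
have IE : \int[mu]_s tail s = I%:E by rewrite fineK.
have kH : (k * fine H = I)%R by rewrite /I -HE -(fineK Hfin) -EFinM.
(* If the integral of [F] vanished, so would [m 1], against [1 <= M 1 * m 1]. *)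
have I_gt0 : (0 < I)%R.
  rewrite lt_neqAle eq_sym fine_ge0// andbT; apply/negP => /eqP I00.
  have m10 : m 1%R <= 0 by apply: le_trans (mI _) _; rewrite IE I00.
  have := sandwich_lower 1%R; rewrite power_kernel2//.
  have -> : m 1%R = 0 by apply/eqP; rewrite eq_le m10 conv_ge0//; exact: tail_ge0.
  by rewrite mule0 lee_fin ler10.
have H_gt0 : (0 < fine H)%R by rewrite -(pmulr_rgt0 _ k0) kH.
split => //; rewrite kH.
apply: slowly_varying_case.
- exact: nearW.
- move=> b b1; have b0 := lt_trans ltr01 b1.
  have e0 : (0 < (1 - b^-1) * I / K)%R.
    by rewrite divr_gt0// mulr_gt0// subr_gt0 invf_lt1.
  apply: filterS2 split_tail (powRN_le_near a20 e0) => t.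
  rewrite IE -(fineK (m_fin t)) -EFinD lee_fin => h1; rewrite ler_pdivlMr// => h2.
  rewrite -!EFinM !lee_fin; split.
    have : (fine (m t) <= I)%R by rewrite -lee_fin fineK ?m_fin// -IE.
    by move=> /le_trans; apply; rewrite ler_peMl ?ltW.
  have h3 : (b^-1 * I <= fine (m t))%R by lra.
  by rewrite -ler_pdivrMl.
- by move=> e e0; apply: near_eq_aeq; apply: nearW => // t; rewrite lee_fin ltW.
Qed.

(** * The range 1 < alpha < 2 *)

Lemma powR_le_decr (r x y : R) : (r <= 0)%R -> (0 < x)%R -> (x <= y)%R ->
  (y `^ r <= x `^ r)%R.
Proof.
move=> r0 x0 xy; have y0 : (0 < y)%R by exact: lt_le_trans xy.
rewrite -(opprK r) !(powRN _ (- r)) lef_pV2 ?posrE ?powR_gt0//.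
by apply: ge0_ler_powR; rewrite ?oppr_ge0 ?nnegrE ?(ltW x0) ?(ltW y0).
Qed.

(** With [a = 2 - alpha] and [b = alpha - 1] one has [a + b = 1], so the model [C t^(a-1)] of [F]
    convolved with [t^(b-1)] is the constant [C] B(a, b), and B(a, b) is the product of the Gamma
    values at [a] and [b] because that at 1 equals 1. *)
Lemma moment_aeq12 : (alpha < 2)%R ->
  aeq M (fun t => ((k * c * fine (eGamma (2 - alpha)) * fine (eGamma (alpha - 1)))^-1 *
                   t `^ (alpha - 1))%:E).
Proof.
move=> alpha2; pose a : R := (2 - alpha)%R; pose b : R := (alpha - 1)%R.
have a0 : (0 < a)%R by rewrite subr_gt0.
have b0 : (0 < b)%R by rewrite subr_gt0.
have b1 : (b < 1)%R by rewrite /b; lra.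
have ab : (a + b = 1)%R by rewrite /a /b; ring.
have bV : (0 < b^-1)%R by rewrite invr_gt0.
pose kb : R -> \bar R := power_kernel b.
have mkb : measurable_fun setT kb := measurable_power_kernel b.
have kb0 s : 0 <= kb s := power_kernel_ge0 b s.
have ckb : causal kb := @power_kernel_causal R b.
have h0 := @heaviside_ge0 R.
have G0 (x : R) : (0 < x)%R -> (x < 2)%R -> (0 < fine (eGamma x))%R.
  by move=> x0 x2; rewrite fine_gt0// eGamma_gt0//= -ge0_fin_numE ?eGamma_ge0// eGamma_fin_num.
have a2 : (a < 2)%R by rewrite /a ltrBlDr ltrDl (lt_trans ltr01).
have b2 : (b < 2)%R by rewrite (lt_trans b1)// ltr1n.
suff main ga gb : eGamma a = ga%:E -> eGamma b = gb%:E -> (0 < ga)%R -> (0 < gb)%R ->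
    aeq M (fun t => ((k * c * ga * gb)^-1 * t `^ b)%:E).
  apply: main; [| |exact: G0..].
    by rewrite fineK// eGamma_fin_num.
  by rewrite fineK// eGamma_fin_num.
move=> gaE gbE Ga Gb.
have BE : conv (power_kernel a) kb 1%R = (ga * gb)%:E.
  by have := eGammaM a b; rewrite ab eGamma1 mule1 gaE gbE => <-.
(* The limit of [w], kept as an opaque constant with its equation. *)
have [gam gamE] : exists x, x = (C * (ga * gb))%R by eexists.
have gam0 : (0 < gam)%R by rewrite gamE !mulr_gt0.
pose g (s : R) : \bar R := C%:E * power_kernel a s.
have g0 s : 0 <= g s by rewrite mule_ge0// lee_fin ltW.
have mg : measurable_fun setT g.
  by apply: measurable_funeM; exact: measurable_power_kernel.
have cg : causal g by move=> s s0; rewrite /g power_kernel_causal// mule0.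
have near0 := nbhs_pinfty_gt (num_real (0%R : R)).
have gkb t : (0 < t)%R -> conv g kb t = gam%:E.
  move=> t0; rewrite convZl ?ltW//; last exact: measurable_power_kernel.
  by rewrite conv_power_kernel// BE ab subrr powRr0 mule1 -EFinM gamE.
(* The kernel [t `^ (b - 1)] tends to 0, hence initial pieces are negligible. *)
have trunc_kb (f : R -> \bar R) A e : (0 < e)%R ->
    (forall s, 0 <= f s) -> measurable_fun setT f -> causal f ->
    conv f heaviside A \is a fin_num ->
    \forall t \near +oo%R, conv (trunc A f) kb t <= e%:E * conv g kb t.
  move=> e0 f0 mf cf fA; pose V := fine (conv f heaviside A).
  have V0 : (0 <= V)%R by rewrite fine_ge0// conv_ge0.
  have e1 : (0 < e * gam / (V + 1))%R.
    by rewrite divr_gt0// ?mulr_gt0// ltr_pwDr.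
  have b10 : (0 < 1 - b)%R by rewrite subr_gt0.
  have small := near_pinfty_shift (- A)%R (powRN_le_near b10 e1).
  apply: filterS3 near0 (nbhs_pinfty_gt (num_real A)) small => t t0 At st.
  have tA : (0 < t - A)%R by rewrite subr_gt0.
  rewrite gkb//; apply: (@le_trans _ _ (((t - A) `^ (b - 1))%:E * conv f heaviside A)).
    apply: conv_trunc_le => //; first exact: powR_ge0.
    move=> s /andP[s0 sA]; have ts : (t - A <= t - s)%R by rewrite lerD2l lerN2 ltW.
    rewrite /kb power_kernel_pos ?(le_trans (ltW tA))// lee_fin.
    by apply: powR_le_decr => //; rewrite subr_le0 ltW.
  rewrite -(fineK fA) -!EFinM lee_fin -/V.
  have -> : (b - 1 = - (1 - b))%R by ring.
  apply: (@le_trans _ _ (e * gam / (V + 1) * V))%R; first by rewrite ler_wpM2r.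
  rewrite mulrAC ler_pdivrMr ?ltr_pwDr// ler_pM2l ?mulr_gt0//.
  by rewrite lerDl.
pose w := conv tail kb.
have mw : measurable_fun setT w by apply: measurable_conv => //; exact: tail_ge0.
have w0 s : 0 <= w s by apply: conv_ge0 => //; exact: tail_ge0.
have cw : causal w by apply: conv_causal => //; exact: tail_causal.
have gh_fin A : conv g heaviside A \is a fin_num.
  rewrite convZl ?ltW//; last exact: measurable_power_kernel.
  by rewrite conv_power_kernel_heaviside.
have w_aeq : aeq w (fun=> gam%:E).
  apply: (@aeq_trans _ (conv g kb)); last first.
    apply: near_eq_aeq; first by apply: filterS near0 => t /gkb.
    by apply: nearW => t; rewrite lee_fin ltW.
  apply: conv_aeq => //.
  - exact: tail_ge0.
  - apply: aeq_trans tail_aeq _; apply: aeq_sym; apply: near_eq_aeq.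
      apply: filterS near0 => t t0.
      rewrite /g power_kernel_pos ?(ltW t0)// -EFinM /a.
      by congr (C * _ `^ _)%:E; ring.
    by apply: nearW => t; rewrite lee_fin mulr_ge0 ?powR_ge0// ltW.
  - by apply: filterS near0 => t /gkb ->.
  - move=> A e e0; apply: trunc_kb => //.
    + exact: tail_ge0.
    + exact: tail_causal.
    + exact: m_fin.
  - by move=> A e e0; exact: trunc_kb.
(* From integrating [t^(b-1)] twice: [w * M = t^(b-1) * 1 * 1 = q t^(b+1)]. *)
pose q := ((b + 1)^-1 * b^-1)%R.
have b10 : (0 < b + 1)%R by rewrite addr_gt0.
have q0 : (0 < q)%R by rewrite mulr_gt0 ?invr_gt0.
have whE t : conv kb (conv heaviside heaviside) t = q%:E * power_kernel (b + 1 + 1) t.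
  rewrite convA// (_ : conv kb heaviside = fun t => b^-1%:E * power_kernel (b + 1) t).
    rewrite convZl ?ltW//; last exact: measurable_power_kernel.
    rewrite conv_power_kernel_heaviside// muleA; congr (_ * _).
    by rewrite -EFinM mulrC.
  by apply/funext => s; exact: conv_power_kernel_heaviside.
have hhE : conv (@heaviside R) heaviside = power_kernel 2%R by apply/funext => s; exact: hh.
have wM t : conv w M t = q%:E * power_kernel (b + 1 + 1) t.
  rewrite -whE hhE (convC mw mM w0 M_ge0) /w (convA mM mtail mkb M_ge0 tail_ge0 kb0).
  have -> : conv M tail = power_kernel 2%R by apply/funext => s; exact: conv_M_tail.
  rewrite (convC (measurable_power_kernel 2%R) mkb)//.
have wh_fin A : conv w heaviside A \is a fin_num.
  rewrite ge0_fin_numE ?conv_ge0//.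
  apply: (@le_lt_trans _ _ (conv kb (conv heaviside heaviside) A)); last first.
    by rewrite whE /power_kernel /heaviside -!EFinM ltry.
  rewrite /w -(convA mtail mkb mh tail_ge0 kb0 h0).
  have mkh := measurable_conv mkb mh kb0 h0.
  have kh0 x : 0 <= conv kb heaviside x by exact: conv_ge0.
  rewrite (convA mkb mh mh kb0 h0 h0) (convC mkh mh kh0 h0).
  apply: le_conv => //; first exact: tail_ge0.
  by move=> s; apply: lee_wpmul2r => //; exact: tail_le1.
(* As [w] is at least [gam / 2] on [[A, A + t]] and [M] is nondecreasing,
   [conv w M (A + t + t)] is at least [gam / 2 * t * M t], so [M t = O(t `^ b)]. *)
have M_small V e : (0 <= V)%R -> (0 < e)%R ->
    \forall t \near +oo%R, M t * V%:E <= e%:E * conv w M t.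
  move=> V0 e0; have [A0 [_ AP]] := w_aeq 2%R (ltr1n R 2).
  pose A := Num.max 0%R (A0 + 1)%R.
  have A_ge0 : (0 <= A)%R by rewrite le_max lexx.
  have wA s : (A <= s)%R -> (gam / 2)%:E <= w s.
    move=> As; have A0s : (A0 < s)%R.
      by apply: lt_le_trans As; rewrite lt_max ltrDl ltr01 orbT.
    have [_] := AP s A0s; case: (w s) (w0 s) => [x _||//]; last by move=> *; rewrite leey.
    by rewrite -EFinM !lee_fin => h; rewrite ler_pdivrMr// mulrC.
  have lowM t : (0 < t)%R -> (fine (M t) * (gam / 2 * t))%:E <= conv w M (A + t + t)%R.
    move=> t0.
    apply: (@le_trans _ _ (\int[mu]_s ((\1_(`[A, A + t]%classic : set R) s)%:E *
        (cst (fine (M t) * (gam / 2))%:E s)))).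
      rewrite -integral_indicM integral_cst//= lebesgue_measure_itv/= lte_fin ltrDl t0.
      by rewrite -EFinB -EFinM lee_fin (addrC A) addrK mulrA.
    apply: ge0_le_integral => //.
    - by move=> s _; rewrite mule_ge0// lee_fin ?mulr_ge0// ?fine_ge0// ltW.
    - apply: emeasurable_funM => //; apply/measurable_EFinP.
      exact: measurable_indic.
    - exact: measurable_conv_fun.
    move=> s _; rewrite indicE; have [|] := boolP (_ \in _); last first.
      by rewrite mul0e mule_ge0.
    rewrite inE/= in_itv/= mul1e => /andP[As sA].
    rewrite EFinM fineK// muleC; apply: lee_pmul => //.
    - by rewrite lee_fin divr_ge0// ltW.
    - exact: wA.
    - by apply: M_nd; rewrite lerBrDr addrC lerD2r.
  (* For [t > A] the argument [A + t + t] is at most [3 t], which gives [M t * V <= K t^b]; this is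
     below [e q t^(b+1)] once [t >= K / (e q)]. *)
  pose K : R := (V * (2 / gam) * (q * 3 `^ (b + 1)))%R.
  have K0 : (0 <= K)%R.
    apply: mulr_ge0; last by apply: mulr_ge0; [exact: ltW|exact: powR_ge0].
    by apply: mulr_ge0 => //; apply: divr_ge0 => //; exact: ltW.
  apply: filterS3 (nbhs_pinfty_gt (num_real A)) near0 (nbhs_pinfty_ge (num_real (K / (e * q)))%R).
  move=> t At t0 Kt; have AT : (A + t + t <= 3 * t)%R by lra.
  have pE : (b + 1 + 1 - 1 = b + 1)%R by ring.
  have AT0 : (0 <= A + t + t)%R by rewrite !addr_ge0// ltW.
  have := lowM t t0; rewrite !wM !power_kernel_pos ?(ltW t0)// pE.
  rewrite -(fineK (M_fin t)) -!EFinM !lee_fin => h1.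
  have h2 : ((A + t + t) `^ (b + 1) <= 3 `^ (b + 1) * t `^ (b + 1))%R.
    rewrite -powRM ?(ltW t0)// ge0_ler_powR ?nnegrE ?mulr_ge0 ?(ltW t0) ?(ltW b10)//.
  have h3 : (fine (M t) * (gam / 2 * t) <= q * (3 `^ (b + 1) * t `^ (b + 1)))%R.
    by apply: le_trans h1 _; rewrite ler_pM2l.
  have gt0 : (0 < gam / 2 * t)%R by rewrite mulr_gt0 ?divr_gt0.
  move: h3; rewrite -ler_pdivlMr// => h3.
  apply: le_trans (ler_wpM2r V0 h3) _.
  have -> : (q * (3 `^ (b + 1) * t `^ (b + 1)) / (gam / 2 * t) * V = K / t * t `^ (b + 1))%R.
    by rewrite /K; field; rewrite !gt_eqF.
  rewrite mulrA ler_wpM2r ?powR_ge0// ler_pdivrMr//.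
  have eq0 : (0 < e * q)%R by exact: mulr_gt0.
  move: Kt; by rewrite (ler_pdivrMr _ _ eq0) (mulrC t).
have convN : aeq (conv M heaviside) (fun t => (gam^-1 * q * t `^ (b + 1))%:E).
  (* [w] is replaced by its limit inside the convolution with [M]. Initial pieces contribute at most
     a multiple of [M t], negligible against [w * M] by [M_small]. *)
  pose f (s : R) : \bar R := gam%:E * heaviside s.
  have f0 s : 0 <= f s by rewrite mule_ge0// lee_fin ltW.
  have mf : measurable_fun setT f by exact: measurable_funeM.
  have cf : causal f by move=> s s0; rewrite /f heaviside_causal// mule0.
  have fh_fin A : conv f heaviside A \is a fin_num.
    by rewrite convZl ?ltW// fin_numM.
  have trM (u : R -> \bar R) A e : (forall s, 0 <= u s) -> measurable_fun setT u ->
      causal u -> conv u heaviside A \is a fin_num -> (0 < e)%R ->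
      \forall t \near +oo%R, conv (trunc A u) M t <= e%:E * conv w M t.
    move=> u0 mu' cu ufin e0.
    have V0 : (0 <= fine (conv u heaviside A))%R by rewrite fine_ge0// conv_ge0.
    apply: filterS (M_small _ e V0 e0) => t; apply: le_trans.
    rewrite -{1}(fineK (M_fin t)) (fineK ufin); apply: conv_trunc_le => //.
      by rewrite fine_ge0.
    by move=> s /andP[s0 _]; rewrite fineK//; apply: M_nd; rewrite gerBl.
  have fw : aeq (conv f M) (conv w M).
    apply: conv_aeq => //.
    - apply: aeq_sym; apply: aeq_trans w_aeq _; apply: aeq_sym; apply: near_eq_aeq.
        by apply: filterS near0 => t t0; rewrite /f heaviside1 ?mule1// ltW.
      by apply: nearW => t; rewrite lee_fin ltW.
    - by apply: nearW => t; rewrite wM /power_kernel /heaviside -!EFinM.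
    - by move=> A e; exact: trM.
    - by move=> A e; exact: trM.
  have gV : (0 <= gam^-1)%R by rewrite invr_ge0 ltW.
  have := aeqZ gV fw.
  have -> : (fun t => gam^-1%:E * conv f M t) = conv M heaviside.
    apply/funext => t; rewrite convZl ?ltW// muleA -EFinM mulVf ?gt_eqF// mul1e.
    by rewrite (convC mM mh).
  move=> /aeq_trans; apply; apply: near_eq_aeq.
    apply: filterS near0 => t t0; rewrite wM power_kernel_pos ?(ltW t0)//.
    by rewrite -!EFinM mulrA; congr (_ * _ `^ _)%:E; ring.
  apply: nearW => t; rewrite lee_fin; apply: mulr_ge0; last exact: powR_ge0.
  by apply: mulr_ge0 => //; exact: ltW.
have D0 : (0 < gam^-1 * q)%R by rewrite mulr_gt0 ?invr_gt0.
have b11 : (1 < b + 1)%R by rewrite ltrDr.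
have := monotone_density M_ge0 M_causal mM M_nd M_fin D0 b11 convN.
(* The constant is [q (b + 1) / gam = 1 / (b gam)], and [b C = k c]. *)
rewrite addrK; congr (aeq M _); apply/funext => t; congr (_ * _)%:E.
rewrite /q gamE /C -/b; field.
by rewrite !gt_eqF.
Qed.

End critical_renewal.

(** * The three regimes of the exponential moment of the local time *)

Theorem proposition3p12 (R : realType) (S : countType) (d : measure_display)
  (T : measurableType d) (X : R -> T -> S) (P : S -> probability T R)
  (hX : markov_chain X P) (i : S) (c alpha kappa : R)
  (hc : 0 < c) (halpha : 0 < alpha)
  (hp : asymp_equiv (fun t => trans_prob X P t i i)
                    (fun t => c * t `^ (- alpha)))
  (hkappa : 0 < kappa) (hkappaG : kappa%:E = ((G_infty X P i)^-1)%E) :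
  [/\ 1 < alpha < 2 ->
        asymp_equiv (fun t => fine (exp_moment X P kappa i t))
          (fun t => t `^ (alpha - 1) *
             ((alpha - 1) /
                (kappa * c * Gamma (2 - alpha) * Gamma alpha))),
      alpha = 2 ->
        asymp_equiv (fun t => fine (exp_moment X P kappa i t))
          (fun t => t / ln t * (1 / (kappa * c)))
    & 2 < alpha ->
        asymp_equiv (fun t => fine (exp_moment X P kappa i t))
          (fun t => t * (1 / (kappa * fine (H_infty X P i))))].
Proof.
pose p := return_prob X P i; pose M := moment X P i kappa.
have k0 := ltW hkappa.
have p0 t : (0 <= p t)%E by exact: return_prob_ge0.
have cp : causal p by exact: return_prob_causal.
have mp : measurable_fun setT p by exact: measurable_return_prob.
have M0 t : (0 <= M t)%E by exact: moment_ge0.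
have cM : causal M by exact: moment_causal.
have mM : measurable_fun setT M by exact: measurable_moment.
have M_nd s t : s <= t -> (M s <= M t)%E by exact: moment_nd.
have M_fin t : M t \is a fin_num.
  have [t0|t0] := ltP t 0; first by rewrite cM.
  by rewrite ge0_fin_numE// (le_lt_trans (moment_le hX i k0 t0))// ltry.
have M_renewal t : (M t = heaviside t + kappa%:E * conv p M t)%E.
  exact: moment_renewal.
have near0 : \forall t \near +oo, 0 < (t : R) by exact: nbhs_pinfty_gt.
have pE t : 0 <= t -> p t = (trans_prob X P t i i)%:E.
  by move=> t0; rewrite /p /return_prob heaviside1// mul1e.
have causalE (f : R -> \bar R) : causal f ->
    (\int[lebesgue_measure]_t f t = \int[lebesgue_measure]_(t in `[0%R, +oo[) f t)%E.
  move=> cf; rewrite [RHS]integral_mkcond; apply: eq_integral => t _.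
  rewrite patchE; case: ifPn => //; rewrite notin_setE/= in_itv/= andbT => /negP.
  by rewrite -ltNge => /cf.
have p_int : (kappa%:E * \int[lebesgue_measure]_t p t = 1)%E.
  have -> : (\int[lebesgue_measure]_t p t = G_infty X P i)%E.
    rewrite causalE//; apply: eq_integral => t; rewrite inE/= in_itv/= andbT.
    exact: pE.
  (* Inversion in the extended reals: a real [kappa > 0] excludes [G_infty = +oo], which would force
     [kappa = 0]. *)
  have -> : G_infty X P i = (kappa^-1)%:E.
    by rewrite -[LHS]inveK -hkappaG inver gt_eqF.
  by rewrite -EFinM mulfV ?gt_eqF.
have H_E : (H_infty X P i = \int[lebesgue_measure]_t (p t * power_kernel 2 t))%E.
  rewrite [RHS]causalE; last by move=> t t0; rewrite cp// mul0e.
  apply: eq_integral => t; rewrite inE/= in_itv/= andbT => t0.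
  by rewrite pE// power_kernel2// -EFinM mulrC.
have p_aeq : aeq p (fun t => (c * t `^ (- alpha))%:E).
  have c0 : \forall t \near +oo, 0 < c * (t : R) `^ (- alpha).
    by apply: filterS near0 => t t0; rewrite mulr_gt0// powR_gt0.
  apply: aeq_trans (asymp_equiv_aeq c0 hp); apply: near_eq_aeq.
    by apply: filterS near0 => t /ltW; exact: pE.
  by apply: nearW => t; rewrite lee_fin fine_ge0.
have concl (g : R -> R) : (\forall t \near +oo, 0 < g t) ->
    aeq M (fun t => (g t)%:E) -> asymp_equiv (fun t => fine (exp_moment X P kappa i t)) g.
  move=> g0 Mg; apply: aeq_asymp_equiv => //; apply: aeq_trans Mg.
  apply: near_eq_aeq; last exact: nearW.
  by apply: filterS near0 => t /ltW t0; rewrite /M /moment heaviside1// mul1e.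
split=> [/andP[a1 a2]|a2|a2].
- have a10 : 0 < alpha - 1 by rewrite subr_gt0.
  have a20 : 0 < 2 - alpha by rewrite subr_gt0.
  have eGammaP (x : R) : 0 < x -> x < 2 -> exists2 g : R, 0 < g & eGamma x = g%:E.
    move=> x0 x2; have Gx := eGamma_fin_num x0 x2.
    by exists (fine (eGamma x)); rewrite ?fineK// -lte_fin fineK// eGamma_gt0.
  have [ga ga0 gaE] : exists2 g : R, 0 < g & eGamma (2 - alpha) = g%:E.
    by apply: eGammaP => //; lra.
  have [gb gb0 gbE] : exists2 g : R, 0 < g & eGamma (alpha - 1) = g%:E.
    by apply: eGammaP => //; lra.
  have [gc _ gcE] := eGammaP _ halpha a2.
  have GaE : Gamma (2 - alpha) = ga by rewrite GammaE gaE.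
  (* The functional equation trades the Gamma value at [alpha - 1] for the one at [alpha], whence
     the factor [alpha - 1] in the numerator. *)
  have GE : Gamma alpha = (alpha - 1) * gb.
    have := eGammaS a10; rewrite gbE subrK gcE => -[->].
    by rewrite GammaE gcE mulVKf// gt_eqF.
  have := moment_aeq12 hkappa p0 cp mp M0 cM mM M_nd M_fin M_renewal p_int hc a1 p_aeq a2.
  rewrite gaE gbE GaE GE => Mg; apply: concl.
    apply: filterS near0 => t t0; apply: mulr_gt0; first exact: powR_gt0.
    by rewrite divr_gt0// !mulr_gt0.
  have <- : (fun t : R => ((kappa * c * ga * gb)^-1 * t `^ (alpha - 1))%:E) =
      (fun t => (t `^ (alpha - 1) * ((alpha - 1) /
        (kappa * c * ga * ((alpha - 1) * gb))))%:E) => //.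
  apply/funext => t; congr EFin; field.
  by rewrite !gt_eqF.
- have a1 : 1 < alpha by rewrite a2 ltr1n.
  have := moment_aeq2 hkappa p0 cp mp M0 cM mM M_nd M_fin M_renewal p_int hc a1 p_aeq a2.
  have -> : (fun t : R => (t / (kappa * c * ln t))%:E) =
      (fun t => (t / ln t * (1 / (kappa * c)))%:E).
    by apply/funext => t; congr EFin; rewrite [in LHS]invfM mul1r mulrA mulrAC.
  apply: concl; apply: filterS (nbhs_pinfty_gt (num_real (1 : R))) => t t1.
  have t0 := lt_trans ltr01 t1.
  by rewrite mulr_gt0 ?divr_gt0 ?ln_gt0 ?mulr_gt0.
- have a1 : 1 < alpha by rewrite (lt_trans _ a2)// ltr1n.
  have [_] := moment_aeq_gt2 hkappa p0 cp mp M0 cM mM M_nd M_fin M_renewal p_int hc a1 p_aeq a2.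
  rewrite -H_E => H0 Mg; apply: concl.
    by apply: filterS near0 => t t0; rewrite mulr_gt0// divr_gt0// mulr_gt0.
  by under eq_fun do rewrite mul1r.
Qed.
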